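(* Let $(x_0,y_0)\in\mathcal{M}_1(p)$ and $d_0=|x_0-y_0|$. Assume that there exists a constant $R>d_0$ such that one of the following holds: $$\text{(a)}\quad \mathcal{A}_{\partial\Omega,y_0}\le\frac1R I,\qquad |\nabla_xl_p(x_0,y_0)|\,(\mathcal{A}_{\partial D,x_0}+\mathcal{A}_{S,x_0})>\frac{R}{(R-d_0)d_0}I;$$ $$\text{(b)}\quad \mathcal{A}_{\partial\Omega,y_0}<\frac1R I,\qquad |\nabla_xl_p(x_0,y_0)|\,(\mathcal{A}_{\partial D,x_0}+\mathcal{A}_{S,x_0})\ge\frac{R}{(R-d_0)d_0}I.$$ Then $(x_0,y_0)$ is a non-degenerate critical point of $l_p$ on $\partial D\times\partial\Omega$.
   Context: Setting. $\Omega\subset\mathbb{R}^3$ is a bounded domain with $C^{2,\alpha_0}$ boundary, $0<\alpha_0\le1$; $D$ is an open subset of $\Omega$ with $C^{2,\alpha_0}$ boundary such that $\overline D\subset\Omega$ and $\Omega\setminus\overline D$ is connected; $p\in\mathbb{R}^3\setminus\overline\Omega$. $\nu_x$ ($x\in\partial D$) and $\nu_y$ ($y\in\partial\Omega$) are the unit outward normals of $D$ and $\Omega$. $l_p(x,y)=|p-x|+|x-y|$ on $\mathbb{R}^3\times\mathbb{R}^3$, with gradient $\nabla_xl_p$ in $x$; $l(p,D)=\inf_{(x,y)\in\partial D\times\partial\Omega}l_p(x,y)$; $\mathcal{M}(p)=\{(x,y)\in\partial D\times\partial\Omega:l_p(x,y)=l(p,D)\}$; $\mathcal{M}_1(p)=\{(x,y)\in\mathcal{M}(p):\nu_x\cdot(p-x)>0,\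 \nu_x\cdot(y-x)>0\}$. $S=\{x\in\mathbb{R}^3:l_p(x,y_0)=l_p(x_0,y_0)\}$ is the spheroid with foci $p,y_0$ through $x_0$; for $(x_0,y_0)\in\mathcal{M}_1(p)$ one has $T_{x_0}(S)=T_{x_0}(\partial D)$ (the outward normals being opposite at $x_0$). Weingarten map. For a $C^2$ surface $\Sigma\subset\mathbb{R}^3$ bounding a bounded open set, with unit outward normal $\nu$, $\mathcal{A}_{\Sigma,x}:T_x(\Sigma)\to T_x(\Sigma)$ is the (self-adjoint) linear map $\mathcal{A}_{\Sigma,x}(v)=D_v\nu$; so $\mathcal{A}_{\Sigma,x}=(1/R)I$ for a sphere of radius $R$. Inequalities between such maps are in the sense of quadratic forms on the tangent space. *)

(* Defs.v *)
From HB Require Import structures.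
From mathcomp Require Import all_boot all_order all_algebra.
From mathcomp Require Import all_classical all_reals all_analysis.

Set Implicit Arguments.
Unset Strict Implicit.
Unset Printing Implicit Defensive.
Import Order.TTheory GRing.Theory Num.Theory.
Import numFieldNormedType.Exports.
Local Open Scope classical_set_scope.
Local Open Scope ring_scope.

(* The library norm on ['rV_n] is the sup norm; it only serves to provide the
   (same) topology and boundedness.  All metric quantities use [enorm]. *)
Definition dot (R : realType) n (u v : 'rV[R]_n) : R :=
  \sum_i u ord0 i * v ord0 i.

Definition enorm (R : realType) n (u : 'rV[R]_n) : R := Num.sqrt (dot u u).

Definition grad (R : realType) n (f : 'rV[R]_n -> R) (x : 'rV[R]_n)
    : 'rV[R]_n :=
  \row_i 'D_(delta_mx ord0 i) f x.

Definition hessian (R : realType) n (f : 'rV[R]_n -> R) (x : 'rV[R]_n)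
    : 'M[R]_n :=
  \matrix_(i, j) 'D_(delta_mx ord0 i) ('D_(delta_mx ord0 j) f) x.

Definition boundary (T : topologicalType) (U : set T) : set T :=
  closure U `\` interior U.

(* Intended for open [A]. *)
Fixpoint Ck (R : realType) (V W : normedModType R) (k : nat) (A : set V)
    (f : V -> W) : Prop :=
  match k with
  | 0%N => forall x, A x -> {for x, continuous f}
  | k'.+1 => (forall x, A x -> differentiable f x) /\
             (forall v, Ck k' A ('D_v f))
  end.

Definition holder_on (R : realType) n (alpha : R) (A : set 'rV[R]_n)
    (f : 'rV[R]_n -> R) : Prop :=
  exists C : R, forall x y, A x -> A y ->
    `|f x - f y| <= C * enorm (x - y) `^ alpha.

Definition C2holder (R : realType) n (alpha : R) (A : set 'rV[R]_n)
    (f : 'rV[R]_n -> R) : Prop :=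
  Ck 2 A f /\ forall v w, holder_on alpha A ('D_w ('D_v f)).

(* Around each boundary point [z], in the coordinates (x - z) Q given by some
   orthonormal frame Q, the set is {x_3 > g(x_1, x_2)} with g of class
   C^{2,alpha}. *)
Definition C2holder_boundary (R : realType) (alpha : R) (U : set 'rV[R]_3)
    : Prop :=
  forall z, boundary U z ->
  exists (Q : 'M[R]_3) (r : R) (g : 'rV[R]_2 -> R),
    [/\ Q *m Q^T = 1%:M, 0 < r,
        C2holder alpha [set s | enorm s < r] g &
        forall x, enorm (x - z) < r ->
          let u : 'rV[R]_(2 + 1) := (x - z) *m Q in
          U x <-> g (lsubmx u) < rsubmx u ord0 ord0].

Definition domain (R : realType) (U : set 'rV[R]_3) : Prop :=
  [/\ U !=set0, open U & connected U].

Definition curve (R : realType) (Sigma : set 'rV[R]_3) (x v : 'rV[R]_3)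
    (c : R -> 'rV[R]_3) : Prop :=
  [/\ c 0 = x, is_derive (0 : R) (1 : R) c v & \forall t \near (0 : R), Sigma (c t)].

Definition tangent (R : realType) (Sigma : set 'rV[R]_3) (x : 'rV[R]_3)
    : set 'rV[R]_3 :=
  [set v | exists c, curve Sigma x v c].

Definition is_outward_normal (R : realType) (U : set 'rV[R]_3)
    (x n : 'rV[R]_3) : Prop :=
  [/\ enorm n = 1,
      forall v, tangent (boundary U) x v -> dot n v = 0 &
      \forall t \near (0 : R)^'+, U (x - t *: n) /\ ~ closure U (x + t *: n)].

(* [xget] selects the unique element of the set when there is one; it returns
   the default value 0 when the set is empty. *)
Definition normal (R : realType) (U : set 'rV[R]_3) (x : 'rV[R]_3)
    : 'rV[R]_3 :=
  xget 0 (is_outward_normal U x).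

(* [weingarten U x v] is D_v nu on the surface [boundary U]: the common
   derivative at 0 of nu along all curves of the surface with velocity [v] at
   [x].  It is meaningful for [v] tangent at [x]. *)
Definition weingarten (R : realType) (U : set 'rV[R]_3) (x v : 'rV[R]_3)
    : 'rV[R]_3 :=
  xget 0 [set w | forall c, curve (boundary U) x v c ->
                    is_derive (0 : R) (1 : R) (normal U \o c) w].

Definition form_le (R : realType) (T : set 'rV[R]_3)
    (A B : 'rV[R]_3 -> 'rV[R]_3) : Prop :=
  forall v, T v -> dot (A v) v <= dot (B v) v.

Definition form_lt (R : realType) (T : set 'rV[R]_3)
    (A B : 'rV[R]_3 -> 'rV[R]_3) : Prop :=
  forall v, T v -> v != 0 -> dot (A v) v < dot (B v) v.

Definition lp (R : realType) (p x y : 'rV[R]_3) : R :=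
  enorm (p - x) + enorm (x - y).

Definition lp_inf (R : realType) (p : 'rV[R]_3) (D Omega : set 'rV[R]_3) : R :=
  inf [set lp p z.1 z.2 | z in boundary D `*` boundary Omega].

Definition Mset (R : realType) (p : 'rV[R]_3) (D Omega : set 'rV[R]_3)
    : set ('rV[R]_3 * 'rV[R]_3) :=
  [set z | (boundary D `*` boundary Omega) z /\
           lp p z.1 z.2 = lp_inf p D Omega].

Definition M1set (R : realType) (p : 'rV[R]_3) (D Omega : set 'rV[R]_3)
    : set ('rV[R]_3 * 'rV[R]_3) :=
  [set z | [/\ Mset p D Omega z,
               0 < dot (normal D z.1) (p - z.1) &
               0 < dot (normal D z.1) (z.2 - z.1)]].

(* The open set bounded by the spheroid S with foci [p], [y0] through [x0]:
   S is its boundary when [x0] is not on the segment [p, y0], as is the case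
   for points of [M1set]. *)
Definition spheroid_inside (R : realType) (p x0 y0 : 'rV[R]_3)
    : set 'rV[R]_3 :=
  [set x | lp p x y0 < lp p x0 y0].

(* [phi] is a C^2 local parametrization at [z] of the subset [M] of [E]:
   a C^2 immersion at 0 mapping neighbourhoods of 0 onto neighbourhoods of [z]
   in [M]. *)
Definition local_param (R : realType) (E : normedModType R) (m : nat)
    (M : set E) (z : E) (phi : 'rV[R]_m -> E) : Prop :=
  [/\ phi 0 = z,
      exists W, [/\ open W, W 0, Ck 2 W phi & phi @` W `<=` M],
      injective ('d phi (0 : 'rV[R]_m)) &
      forall W, nbhs (0 : 'rV[R]_m) W ->
        \forall y \near within M (nbhs z), (phi @` W) y].

(* The conditions on gradient and Hessian do not depend on the
   parametrization; they are required for all of them, and the first clause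
   (M is an m-dimensional C^2 manifold near z) excludes vacuity. *)
Definition nondegenerate_critical (R : realType) (E : normedModType R)
    (m : nat) (M : set E) (f : E -> R) (z : E) : Prop :=
  (exists phi : 'rV[R]_m -> E, local_param M z phi) /\
  forall phi : 'rV[R]_m -> E, local_param M z phi ->
    grad (f \o phi) 0 = 0 /\ \det (hessian (f \o phi) 0) != 0.

(* Main.v *)
(* If d is the distance |x0 - y0| and L = |grad_x l_p(x0, y0)|, the second
   derivative of l_p along a path of the product of the two surfaces with
   velocity (v, w) at (x0, y0) is
     L <(A_D + A_S) v, v> - 2 <v, w> / d + |w|^2 / d - <A_Omega w, w>.
   Minimality makes grad_x l_p equal to - L nu_x and (y0 - x0) / d equal to nu_y,
   so the accelerations of the path enter only through <nu, X''> = - <A X', X'>,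
   and the Hessian of l_p(., y0) restricted to the tangent plane is L A_S.
   With m = 1/d - 1/R, either hypothesis bounds this form from below, strictly
   off the origin, by |v|^2 / (m d^2) - 2 <v, w> / d + m |w|^2, which is
   m |w - v / (m d)|^2.  A positive definite Hessian is non-singular. *)
From HB Require Import structures.
Require Import Defs.
From mathcomp Require Import all_boot all_order all_algebra.
From mathcomp Require Import all_classical all_reals all_analysis.
From mathcomp Require Import ring lra.
Import Order.TTheory GRing.Theory Num.Theory.
Import numFieldNormedType.Exports.
Local Open Scope classical_set_scope.
Local Open Scope ring_scope.

Set Implicit Arguments.
Unset Strict Implicit.
Unset Printing Implicit Defensive.

(** * Dot product and differential calculus *)

(** The obstacle is that [normal] and [weingarten] are selected by [xget] from conditions on all
    curves of a set, so they can be computed only once existence and uniqueness are known. The two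
    boundaries and the spheroid are therefore put in one form, [C2_at]: a function negative exactly
    inside, whose gradient does not vanish near the point and is differentiable there. For the
    boundaries it is the height of the local graph above the point, for the spheroid the excess of
    length. Tangent vectors, normals and Weingarten maps are then treated once for all three
    surfaces. Nondegeneracy is required in every parametrization, so the Hessian is computed in an
    arbitrary one, restricted to lines through 0, and the graphs serve to exhibit one
    parametrization. That nu_y is (y0 - x0) / d and not its opposite is not a first-order fact: it
    holds because the segment from x0 to y0 stays in [Omega] before reaching y0. *)

Lemma dotC (R : realType) n (u v : 'rV[R]_n) : dot u v = dot v u.
Proof. by apply: eq_bigr => i _; rewrite mulrC. Qed.

Lemma dotDl (R : realType) n (u v w : 'rV[R]_n) :
  dot (u + v) w = dot u w + dot v w.
Proof. by rewrite -big_split; apply: eq_bigr => i _; rewrite mxE mulrDl. Qed.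

Lemma dotZl (R : realType) n a (u v : 'rV[R]_n) : dot (a *: u) v = a * dot u v.
Proof. by rewrite /dot mulr_sumr; apply: eq_bigr => i _; rewrite mxE mulrA. Qed.

Lemma dotNl (R : realType) n (u v : 'rV[R]_n) : dot (- u) v = - dot u v.
Proof. by rewrite -scaleN1r dotZl mulN1r. Qed.

Lemma dotBl (R : realType) n (u v w : 'rV[R]_n) :
  dot (u - v) w = dot u w - dot v w.
Proof. by rewrite dotDl dotNl. Qed.

Lemma dot0l (R : realType) n (v : 'rV[R]_n) : dot 0 v = 0.
Proof. by rewrite -(scale0r v) dotZl mul0r. Qed.

Lemma dotDr (R : realType) n (u v w : 'rV[R]_n) :
  dot w (u + v) = dot w u + dot w v.
Proof. by rewrite dotC dotDl !(dotC w). Qed.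

Lemma dotZr (R : realType) n a (u v : 'rV[R]_n) : dot u (a *: v) = a * dot u v.
Proof. by rewrite dotC dotZl dotC. Qed.

Lemma dotNr (R : realType) n (u v : 'rV[R]_n) : dot u (- v) = - dot u v.
Proof. by rewrite dotC dotNl dotC. Qed.

Lemma dotBr (R : realType) n (u v w : 'rV[R]_n) :
  dot w (u - v) = dot w u - dot w v.
Proof. by rewrite dotDr dotNr. Qed.

Lemma dot0r (R : realType) n (v : 'rV[R]_n) : dot v 0 = 0.
Proof. by rewrite dotC dot0l. Qed.

Definition dotE := (dotDl, dotDr, dotBl, dotBr, dotNl, dotNr, dotZl, dotZr).

Lemma dot_ge0 (R : realType) n (u : 'rV[R]_n) : 0 <= dot u u.
Proof. by apply: sumr_ge0 => i _; rewrite -expr2 sqr_ge0. Qed.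

Lemma dot_eq0 (R : realType) n (u : 'rV[R]_n) : (dot u u == 0) = (u == 0).
Proof.
apply/idP/eqP => [|->]; last by rewrite dot0l.
rewrite psumr_eq0 => [/allP u0|i _]; last by rewrite -expr2 sqr_ge0.
apply/rowP => i; rewrite mxE.
by have := u0 i (mem_index_enum i); rewrite mulf_eq0 orbb => /eqP.
Qed.

Lemma dot_gt0 (R : realType) n (u : 'rV[R]_n) : (0 < dot u u) = (u != 0).
Proof. by rewrite lt0r dot_ge0 andbT dot_eq0. Qed.

Lemma enorm_ge0 (R : realType) n (u : 'rV[R]_n) : 0 <= enorm u.
Proof. exact: sqrtr_ge0. Qed.

Lemma sqr_enorm (R : realType) n (u : 'rV[R]_n) : enorm u ^+ 2 = dot u u.
Proof. by rewrite sqr_sqrtr// dot_ge0. Qed.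

Lemma enorm_gt0 (R : realType) n (u : 'rV[R]_n) : (0 < enorm u) = (u != 0).
Proof. by rewrite sqrtr_gt0 dot_gt0. Qed.

Lemma enorm_eq0 (R : realType) n (u : 'rV[R]_n) : (enorm u == 0) = (u == 0).
Proof. by have := enorm_gt0 u; rewrite lt0r enorm_ge0 andbT => /negb_inj. Qed.

Lemma enormN (R : realType) n (u : 'rV[R]_n) : enorm (- u) = enorm u.
Proof. by rewrite /enorm dotNl dotNr opprK. Qed.

Lemma enormBC (R : realType) n (u v : 'rV[R]_n) : enorm (u - v) = enorm (v - u).
Proof. by rewrite -enormN opprB. Qed.

Lemma enormZ (R : realType) n a (u : 'rV[R]_n) : enorm (a *: u) = `|a| * enorm u.
Proof.
by rewrite /enorm dotZl dotZr mulrA -expr2 sqrtrM ?sqr_ge0// sqrtr_sqr.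
Qed.

Lemma enorm_normalize (R : realType) n (u : 'rV[R]_n) :
  u != 0 -> enorm ((enorm u)^-1 *: u) = 1.
Proof.
move=> u0; rewrite enormZ ger0_norm ?invr_ge0 ?enorm_ge0// mulVf//.
by rewrite enorm_eq0.
Qed.

Lemma differentiable_dot (R : realType) (V : normedModType R) n
    (f g : V -> 'rV[R]_n) x :
  differentiable f x -> differentiable g x ->
  differentiable (fun z => dot (f z) (g z) : R) x.
Proof.
move=> df dg; rewrite (_ : (fun z => _) =
    \sum_i ((fun z => f z ord0 i : R) * (fun z => g z ord0 i : R))); last first.
  by apply/funext => z; rewrite fct_sumE.
apply: differentiable_sum => i; apply: differentiableM.
  exact: (differentiable_comp df (differentiable_coord _ _ _)).
exact: (differentiable_comp dg (differentiable_coord _ _ _)).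
Qed.

Lemma differentiable_row (R : realType) (V : normedModType R) n
    (f : V -> 'rV[R]_n) x :
  (forall i, differentiable (fun z => f z ord0 i : R) x) -> differentiable f x.
Proof.
move=> df; rewrite (_ : f = \sum_i (fun z => f z ord0 i *: delta_mx ord0 i)).
  by apply: differentiable_sum => i; apply: differentiableZl.
by apply/funext => z; rewrite fct_sumE -row_sum_delta.
Qed.

Lemma differentiable_scale (R : realType) (V : normedModType R) n
    (k : V -> R) (f : V -> 'rV[R]_n) x :
  differentiable k x -> differentiable f x ->
  differentiable (fun z => k z *: f z) x.
Proof.
move=> dk df; apply: differentiable_row => i.
rewrite (_ : (fun z => _) = k * (fun z => f z ord0 i : R)).
  apply: differentiableM => //.
  exact: (differentiable_comp df (differentiable_coord _ _ _)).
by apply/funext => z; rewrite mxE.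
Qed.

Lemma differentiable_enorm (R : realType) (V : normedModType R) n
    (f : V -> 'rV[R]_n) x :
  differentiable f x -> f x != 0 -> differentiable (fun z => enorm (f z) : R) x.
Proof.
move=> df f0; apply: (differentiable_comp (differentiable_dot df df)).
have p0 : 0 < dot (f x) (f x) by rewrite dot_gt0.
by apply/derivable1_diffP; case: (is_derive1_sqrt p0).
Qed.

Lemma is_derive_diff (R : realType) (V W : normedModType R) (f : V -> W) x v :
  differentiable f x -> is_derive x v f ('d f x v).
Proof. by move=> df; rewrite -deriveE//; apply/derivableP/diff_derivable. Qed.

(** In one real variable derivable and differentiable agree. Passing to the line through [x] thus
    transfers the rules for differentials to maps that are only derivable along [v]. *)
Lemma is_derive_line (R : realType) (V W : normedModType R) (f : V -> W) x v df :
  is_derive x v f df <->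
  is_derive (0 : R) (1 : R) (fun t : R => f (t *: v + x)) df.
Proof.
have E : 'D_v f x = 'D_1 (fun t : R => f (t *: v + x)) 0.
  rewrite /derive; set g1 := fun h => _; set g2 := fun h => _.
  suff -> : g1 = g2 by [].
  by apply/funext => h; rewrite /g1 /g2 /= addr0 scale0r add0r [_%:A]mulr1.
split=> -[d <-].
  by split; [exact: (derivable1P f x v).1|rewrite E].
by split; [exact: (derivable1P f x v).2|rewrite E].
Qed.

Lemma is_derive_comp (R : realType) (U V W : normedModType R) (c : U -> V)
    (f : V -> W) x v dc :
  is_derive x v c dc -> differentiable f (c x) ->
  is_derive x v (f \o c) ('d f (c x) dc).
Proof.
move=> /is_derive_line [d e] df; apply/is_derive_line.
pose l t := c (t *: v + x).
have dl : differentiable l 0 by apply/derivable1_diffP.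
have df' : differentiable f (l 0) by rewrite /l scale0r add0r.
have := is_derive_diff (1 : R) (differentiable_comp dl df').
by rewrite (diff_comp dl df') /= -(deriveE _ dl) e /l scale0r add0r.
Qed.

Lemma is_derive_curve (R : realType) (V W : normedModType R) (c : R -> V)
    (f : V -> W) t v :
  is_derive t (1 : R) c v -> differentiable f (c t) ->
  is_derive t (1 : R) (f \o c) ('d f (c t) v).
Proof. exact: is_derive_comp. Qed.

Lemma is_derive_lin (R : realType) (V W : normedModType R) (U : normedModType R)
    (f : U -> V) (L : {linear V -> W}) x v df :
  continuous L -> is_derive x v f df -> is_derive x v (fun z => L (f z)) (L df).
Proof.
move=> cL /is_derive_line H; apply/is_derive_line.
have := is_derive_comp H (linear_differentiable (_ : V) cL).
by rewrite diff_lin.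
Qed.

Lemma is_derive_coord (R : realType) (V : normedModType R) n
    (f : V -> 'rV[R]_n) x v df :
  is_derive x v f df <->
  forall i, is_derive x v (fun z => f z ord0 i : R) (df ord0 i).
Proof.
split=> [[d <-] i|H].
  by rewrite derive_mx// mxE; apply/derivableP/(derivable_mxP _ _ _).1.
have d : derivable f x v.
  by apply/derivable_mxP => i j; rewrite ord1; case: (H j).
split=> //; rewrite derive_mx//; apply/rowP => i; rewrite mxE.
by case: (H i).
Qed.

Lemma is_derive_dot (R : realType) (V : normedModType R) n
    (f g : V -> 'rV[R]_n) x v df dg :
  is_derive x v f df -> is_derive x v g dg ->
  is_derive x v (fun z => dot (f z) (g z) : R) (dot df (g x) + dot (f x) dg).
Proof.
move=> /is_derive_coord Hf /is_derive_coord Hg.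
rewrite (_ : (fun z => _) =
    \sum_i ((fun z => f z ord0 i : R) * (fun z => g z ord0 i : R))); last first.
  by apply/funext => z; rewrite fct_sumE.
apply: is_derive_eq; rewrite /dot -big_split; apply: eq_bigr => i _ /=.
by rewrite addrC [df ord0 i * _]mulrC.
Qed.

Lemma is_derive_scale (R : realType) (V : normedModType R) n
    (k : V -> R) (f : V -> 'rV[R]_n) x v dk df :
  is_derive x v k dk -> is_derive x v f df ->
  is_derive x v (fun z => k z *: f z) (dk *: f x + k x *: df).
Proof.
move=> Hk /is_derive_coord Hf; apply/is_derive_coord => i.
rewrite (_ : (fun z => _) = k * (fun z => f z ord0 i : R)); last first.
  by apply/funext => z; rewrite mxE.
apply: (is_derive_eq (is_deriveM Hk (Hf i))).
by rewrite !mxE addrC [dk * _]mulrC.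
Qed.

Lemma is_derive_sqrt_comp (R : realType) (V : normedModType R) (f : V -> R)
    x v df :
  is_derive x v f df -> 0 < f x ->
  is_derive x v (fun z => Num.sqrt (f z) : R) (df / (2 * Num.sqrt (f x))).
Proof.
move=> /is_derive_line Hf f0; apply/is_derive_line.
rewrite mulrC; apply: is_derive1_comp.
by rewrite scale0r add0r; apply: is_derive1_sqrt.
Qed.

Lemma is_derive_enorm (R : realType) (V : normedModType R) n
    (f : V -> 'rV[R]_n) x v df :
  is_derive x v f df -> f x != 0 ->
  is_derive x v (fun z => enorm (f z) : R) (dot (f x) df / enorm (f x)).
Proof.
move=> Hf f0; have f0' : 0 < dot (f x) (f x) by rewrite dot_gt0.
apply: (is_derive_eq (is_derive_sqrt_comp (is_derive_dot Hf Hf) f0')).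
have : enorm (f x) != 0 by rewrite enorm_eq0.
by rewrite -/(enorm _) (dotC df) => ?; field.
Qed.

Lemma is_derive_div (R : realType) (V : normedModType R) (f g : V -> R)
    x v df dg :
  is_derive x v f df -> is_derive x v g dg -> g x != 0 ->
  is_derive x v (fun z => f z / g z : R) (df / g x - f x * dg / g x ^+ 2).
Proof.
move=> Hf Hg g0.
have Hi : is_derive x v (fun z => (g z)^-1 : R) (- (g x) ^- 2 *: dg).
  have [d <-] := Hg; rewrite -deriveV//.
  exact/derivableP/derivableV.
apply: (is_derive_eq (is_deriveM Hf Hi)).
by rewrite /GRing.scale /=; field.
Qed.

Lemma is_derive_continuous (R : realType) (V : normedModType R) (c : R -> V)
    t v : is_derive t (1 : R) c v -> c s @[s --> t] --> c t.
Proof.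
by move=> [dc _]; apply/differentiable_continuous/derivable1_diffP.
Qed.

Lemma curve_near (R : realType) (V : normedModType R) (c : R -> V) t v x
    (P : set V) :
  is_derive t (1 : R) c v -> c t = x -> nbhs x P -> \forall s \near t, P (c s).
Proof. by move=> /is_derive_continuous cc <- /cc. Qed.

Lemma derive_neg_lt (R : realType) (q : R -> R) d :
  is_derive (0 : R) (1 : R) q d -> d < 0 -> \forall t \near (0 : R)^'+, q t < q 0.
Proof.
move=> [dq <-] d0; move/cvgr_lt : (dq) => /(_ 0 d0).
rewrite !near_withinE; apply: filterS => h /= Hh h0.
have := Hh (lt0r_neq0 h0).
rewrite addr0 [h *: 1]mulr1 -[h^-1 *: _]/(h^-1 * _).
by rewrite pmulr_rlt0 ?invr_gt0// subr_lt0.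
Qed.

Lemma derive_local_min (R : realType) (q : R -> R) d :
  is_derive (0 : R) (1 : R) q d -> (\forall t \near (0 : R), q 0 <= q t) -> d = 0.
Proof.
move=> Hq qmin; apply/eqP; rewrite eq_le.
(* The sign [(-1) ^+ b] runs the one-sided test on the right and on the left of 0 at once. *)
have N0 (b : bool) : ~ d * (-1) ^+ b < 0.
  move=> d0.
  have Hb : is_derive (0 : R) (1 : R) (fun t : R => q (t * (-1) ^+ b)) (d * (-1) ^+ b).
    apply: (@is_derive1_comp R q (fun t => t * (-1) ^+ b)).
      by rewrite mul0r.
    apply: (is_derive_eq (is_deriveM (is_derive_id _ _) (is_derive_cst _ _ _))).
    by rewrite scaler0 add0r [_ *: _]mulr1.
  have := derive_neg_lt Hb d0; rewrite mul0r => lt0.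
  have qmin' : \forall t \near (0 : R)^'+, q 0 <= q (t * (-1) ^+ b).
    apply: (@cvg_within _ (nbhs (0 : R))).
    have C := @mulrr_continuous R ((-1) ^+ b) 0.
    by rewrite /continuous_at mul0r in C; exact: (C _ qmin).
  near (0 : R)^'+ => t.
  have : q 0 < q 0; last by rewrite ltxx.
  apply: (@le_lt_trans _ _ (q (t * (-1) ^+ b))); first by near: t.
  by near: t.
have := N0 false; have := N0 true.
rewrite expr0 expr1 mulr1 mulrN1 oppr_lt0 => /negP; rewrite -leNgt => ->.
by move=> /negP; rewrite -leNgt => ->.
Unshelve. all: by end_near. Qed.

(** * Level sets, normals and the Weingarten map *)

Lemma gradE (R : realType) n (F : 'rV[R]_n -> R) x v :
  differentiable F x -> 'd F x v = dot (grad F x) v.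
Proof.
move=> dF; rewrite [v in LHS]row_sum_delta linear_sum /dot.
apply: eq_bigr => i _; rewrite linearZ /= mxE deriveE//.
by rewrite mulrC.
Qed.

Lemma is_derive_ray (R : realType) n (F : 'rV[R]_n -> R) z e :
  differentiable F z ->
  is_derive (0 : R) (1 : R) (fun t : R => F (t *: e + z)) (dot (grad F z) e).
Proof.
by move=> dF; apply: (is_derive_line _ _ _ _).1; rewrite -gradE//; exact: is_derive_diff.
Qed.

Lemma descent_ray (R : realType) n (F : 'rV[R]_n -> R) z e :
  differentiable F z -> F z = 0 -> dot (grad F z) e < 0 ->
  \forall t \near (0 : R)^'+, F (t *: e + z) < 0.
Proof.
move=> dF F0 e0; have := derive_neg_lt (is_derive_ray e dF) e0.
by rewrite scale0r add0r F0.
Qed.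

Lemma diff_approx (R : realType) (V : normedModType R) (F : V -> R) z e :
  differentiable F z -> 0 < e ->
  \forall u \near (0 : V), `|F (u + z) - F z - 'd F z u| <= e * `|u|.
Proof.
move=> /diff_locally /eqaddoP /(_ _) H e0; move/(_ _ e0): H.
by apply: filterS => u /=; rewrite opprD addrA.
Qed.

(** Uniformity in [h] is the point: [curve_exists] finds its correction [h] only after [s] is
    fixed. *)
Lemma near_cone (R : realType) (V : normedModType R) (z v w : V) (P : set V) :
  nbhs z P -> \forall s \near (0 : R),
    forall h, `|h| <= `|s| -> P (s *: v + h *: w + z).
Proof.
move=> /nbhs_ballP[r /= r0 rP].
have K0 : 0 < `|v| + `|w| + 1.
  by rewrite ltr_wpDl// addr_ge0.
have : \forall s \near (0 : R), `|s| < r / (`|v| + `|w| + 1).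
  by apply: nbhs0_lt; rewrite divr_gt0.
apply: filterS => s; rewrite ltr_pdivlMr// => sr h hs.
apply: rP; rewrite -ball_normE /= opprD addrCA subrr addr0 normrN.
apply: le_lt_trans sr.
rewrite (le_trans (ler_normD _ _))// !normrZ mulrDr mulr1.
rewrite ler_wpDr// mulrDr lerD2l ler_wpM2r//.
Qed.

Lemma near_ray (R : realType) (V : normedModType R) (z e : V) (P : set V) :
  nbhs z P -> \forall t \near (0 : R)^'+, P (t *: e + z).
Proof.
move=> /(near_cone e 0) H; apply: (@cvg_within _ (nbhs (0 : R))).
by apply: filterS H => t /(_ 0); rewrite normr0 scaler0 addr0; apply.
Qed.

(** Replaces the implicit function theorem. For each small [s] the point [s *: v + z] is corrected
    along the gradient until [F] vanishes; the correction is of smaller order than [s], so the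
    velocity at 0 is still [v]. *)
Lemma curve_exists (R : realType) n (F : 'rV[R]_n -> R) z v :
  (\forall z' \near z, differentiable F z') -> grad F z != 0 -> F z = 0 ->
  dot (grad F z) v = 0 ->
  exists c : R -> 'rV[R]_n, [/\ c 0 = z, is_derive (0 : R) (1 : R) c v
    & \forall t \near (0 : R), F (c t) = 0].
Proof.
move=> dF N0 F0 Nv; have dFz := nbhs_singleton dF.
set N := grad F z in N0 Nv *.
have k0 : 0 < dot N N by rewrite dot_gt0.
have K0 : 0 < `|v| + `|N| + 1 by rewrite ltr_wpDl// addr_ge0.
(* Since [v] is orthogonal to [N], the linear part of [F] at the displaced point is [h * dot N N].
   The displacement has norm at most [|s| (|v| + |N|)], hence the rescaled tolerance; the added 1
   keeps the denominator positive. *)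
have approx e : 0 < e -> \forall s \near (0 : R), forall h, `|h| <= `|s| ->
    `|F (s *: v + h *: N + z) - h * dot N N| <= e * `|s|.
  move=> e0; have e'0 : 0 < e / (`|v| + `|N| + 1) by rewrite divr_gt0.
  have := near_cone v N (diff_approx dFz e'0).
  apply: filterS => s H h hs; have := H h hs.
  rewrite addr0 F0 subr0 gradE// -/N !dotE Nv mulr0 add0r => /le_trans; apply.
  rewrite -mulrA ler_pM2l// ler_pdivrMl// mulrC.
  rewrite (le_trans (ler_normD _ _))// !normrZ mulrDr mulr1.
  by rewrite ler_wpDr// mulrDr lerD2l ler_wpM2r.
(* With tolerance [dot N N / 2], the value of [F] at [h = |s|] is nonnegative and at [h = - |s|]
   nonpositive, so the intermediate value theorem gives a root in between. *)
have root : \forall s \near (0 : R), exists h, `|h| <= `|s| /\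
    F (s *: v + h *: N + z) = 0.
  have := approx _ (divr_gt0 k0 (ltr0Sn _ 1)); have := near_cone v N dF.
  apply: filterS2 => s dFs H.
  have ss : - `|s| <= `|s| by rewrite (@le_trans _ _ 0)// oppr_le0.
  have cF : {within `[- `|s|, `|s|],
      continuous (fun h : R => F (s *: v + h *: N + z))}.
    apply: continuous_in_subspaceT => h; rewrite inE /= in_itv /= -ler_norml => hs.
    apply: differentiable_continuous.
    have dl : differentiable (cst (s *: v) + (fun h : R => h *: N) + cst z) h.
      apply: differentiableD; last exact: differentiable_cst.
      apply: differentiableD; first exact: differentiable_cst.
      exact: (@differentiable_scale _ _ _ id).
    by have := differentiable_comp dl (dFs _ hs); apply.
  have [|h] := @IVT R _ _ _ 0 ss cF.
    have := H (- `|s|); rewrite normrN normr_id lexx => /(_ isT).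
    have := H `|s|; rewrite normr_id lexx => /(_ isT).
    rewrite !ler_norml => /andP[h1 h2] /andP[h3 h4].
    have sk : 0 <= dot N N / 2 * `|s| by rewrite mulr_ge0// divr_ge0// ltW.
    rewrite ge_min le_max; apply/andP; split; apply/orP; [left|right]; lra.
  by rewrite in_itv /= -ler_norml => hs Fh; exists h.
(* The root is chosen separately for each [s], with no continuity in [s]; the bound by [|s|] alone
   forces [h 0 = 0]. *)
pose h (s : R) := xget 0 [set h | `|h| <= `|s| /\ F (s *: v + h *: N + z) = 0].
have rooth : \forall s \near (0 : R), `|h s| <= `|s| /\
    F (s *: v + h s *: N + z) = 0.
  apply: filterS root => s [r Hr].
  exact: (@xgetPex _ _ [set h | _ /\ _] (ex_intro _ r Hr)).
have h0 : h 0 = 0.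
  by have [] := nbhs_singleton rooth; rewrite normr0 normr_le0 => /eqP.
(* At a root the approximation reads [|h s| * dot N N <= e |s|] for every positive [e], so the
   difference quotients of [h] tend to 0. *)
have dh : is_derive (0 : R) (1 : R) h 0.
  have hl : (fun t : R => t^-1 *: ((h \o shift 0) (t *: (1 : R)) - h 0)) @ 0^'
      --> (0 : R).
    apply/cvgrPdist_le => e e0.
    have ek : 0 < e * dot N N by rewrite mulr_gt0.
    rewrite near_withinE.
    have := approx _ ek; apply: filterS2 rooth => t [ht Ft] /(_ _ ht).
    rewrite Ft sub0r normrN normrM (gtr0_norm k0) => hk t0.
    rewrite /= addr0 [_ *: 1]mulr1 h0 subr0 sub0r normrN normrZ normfV.
    rewrite ler_pdivrMl ?normr_gt0// mulrC.
    by rewrite -(ler_pM2r k0) mulrAC.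
  by split; [apply/cvg_ex; exists 0|exact: cvg_lim hl].
exists (fun s => s *: v + h s *: N + z); split.
- by rewrite h0 !scale0r !add0r.
- have dc := is_deriveD (is_deriveD (is_derive_scale (is_derive_id _ _)
    (is_derive_cst v _ _)) (is_derive_scale dh (is_derive_cst N _ _)))
    (is_derive_cst z (0 : R) (1 : R)).
  by apply: (is_derive_eq dc); rewrite !scaler0 !scale0r scale1r !addr0.
- by apply: filterS rooth => s [].
Qed.

(* The only data about [U] needed near a boundary point: a function that is
   negative exactly on [U] and has no critical point. *)
Definition regular_at (R : realType) (U : set 'rV[R]_3) (F : 'rV[R]_3 -> R)
    (z : 'rV[R]_3) : Prop :=
  \forall z' \near z,
    [/\ differentiable F z', grad F z' != 0 & U z' <-> F z' < 0].

Lemma regular_near (R : realType) (U : set 'rV[R]_3) F z :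
  regular_at U F z -> \forall z' \near z, regular_at U F z'.
Proof. exact: near_join. Qed.

Lemma regular_closure (R : realType) (U : set 'rV[R]_3) F z :
  regular_at U F z -> closure U z -> F z <= 0.
Proof.
move=> rF Uz; have [dF _ _] := nbhs_singleton rF.
rewrite leNgt; apply/negP => F0.
have Fp : \forall z' \near z, 0 < F z'.
  by have /cvgr_gt := differentiable_continuous dF; apply.
have [z' [Uz' [/= Fz' [_ _ UFz']]]] := Uz _ (filterI Fp rF).
by move: Uz' => /UFz'; rewrite ltNge ltW.
Qed.

(** The closure lies in [F <= 0], and where [F] is negative the point is interior. Conversely, a
    small step from a zero against the gradient lands in [U], which puts the zero in the closure. *)
Lemma regular_boundary (R : realType) (U : set 'rV[R]_3) F z :
  regular_at U F z -> boundary U z <-> F z = 0.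
Proof.
move=> rF; have [dF N0 UF] := nbhs_singleton rF; split.
  move=> [/(regular_closure rF) Fle nint].
  apply/eqP; rewrite eq_le Fle leNgt; apply/negP => Fz; apply: nint.
  have Fn : \forall z' \near z, F z' < 0.
    by have /cvgr_lt := differentiable_continuous dF; apply.
  by apply: filterS2 Fn rF => z' F' [_ _ /iffRL]; apply.
move=> F0; split=> [B Bz|/nbhs_singleton /UF]; last by rewrite F0 ltxx.
have Fn : \forall t \near (0 : R)^'+, F (t *: (- grad F z) + z) < 0.
  by apply: descent_ray => //; rewrite dotNr oppr_lt0 dot_gt0.
near (0 : R)^'+ => t.
exists (t *: (- grad F z) + z); split; last by near: t; exact: near_ray.
have [_ _ UFt] : [/\ differentiable F (t *: (- grad F z) + z),
    grad F (t *: (- grad F z) + z) != 0 &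
    U (t *: (- grad F z) + z) <-> F (t *: (- grad F z) + z) < 0].
  by near: t; exact: (near_ray _ rF).
by apply/UFt; near: t.
Unshelve. all: by end_near. Qed.

(** Differentiating [F] along a curve gives one direction; the other needs an actual curve for each
    velocity and rests on [curve_exists]. *)
Lemma regular_tangent (R : realType) (U : set 'rV[R]_3) F z v :
  regular_at U F z -> F z = 0 ->
  tangent (boundary U) z v <-> dot (grad F z) v = 0.
Proof.
move=> rF F0; have [dF N0 UF] := nbhs_singleton rF.
have bd : \forall z' \near z, boundary U z' <-> F z' = 0.
  by apply: filterS (regular_near rF) => z'; exact: regular_boundary.
split=> [[c [c0 dc bc]]|Nv].
  rewrite -gradE//.
  have dFc : differentiable F (c 0) by rewrite c0.
  have := is_derive_curve dc dFc; rewrite c0 => -[_ <-].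
  rewrite (near_eq_derive (g := cst 0)) ?derive_cst//.
  have cc : \forall t \near (0 : R), boundary U (c t) <-> F (c t) = 0.
    exact: (curve_near dc c0 bd).
  by apply: filterS2 bc cc => t bt /iffLR; apply.
have dF' : \forall z' \near z, differentiable F z'.
  by apply: filterS rF => z' [].
have [c [c0 dc Fc]] := curve_exists dF' N0 F0 Nv.
exists c; split=> //.
have cc : \forall t \near (0 : R), boundary U (c t) <-> F (c t) = 0.
  exact: (curve_near dc c0 bd).
by apply: filterS2 Fc cc => t bt /iffRL; apply.
Qed.

Lemma regular_outward_normal (R : realType) (U : set 'rV[R]_3) F z :
  regular_at U F z -> F z = 0 ->
  is_outward_normal U z ((enorm (grad F z))^-1 *: grad F z).
Proof.
move=> rF F0; have [dF N0 UF] := nbhs_singleton rF.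
set N := grad F z in N0 *; have k0 : 0 < (enorm N)^-1 by rewrite invr_gt0 enorm_gt0.
split.
- exact: enorm_normalize.
- by move=> v /(regular_tangent _ rF F0) Nv; rewrite dotZl Nv mulr0.
- set n := _ *: _.
  have Fn : \forall t \near (0 : R)^'+, F (t *: (- n) + z) < 0.
    apply: descent_ray => //.
    by rewrite dotNr oppr_lt0 dotZr mulr_gt0// dot_gt0.
  have Fp : \forall t \near (0 : R)^'+, 0 < F (t *: n + z).
    have dG : is_derive (0 : R) (1 : R) (fun t : R => - F (t *: n + z))
        (- dot (grad F z) n) by exact: is_deriveN (is_derive_ray n dF).
    have /(derive_neg_lt dG) : - dot (grad F z) n < 0.
      by rewrite oppr_lt0 dotZr mulr_gt0// dot_gt0.
    by rewrite scale0r add0r F0; apply: filterS => t; rewrite oppr0 oppr_lt0.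
  near=> t; split.
    rewrite addrC -scalerN.
    have [_ _ UFt] : [/\ differentiable F (t *: (- n) + z),
        grad F (t *: (- n) + z) != 0 &
        U (t *: (- n) + z) <-> F (t *: (- n) + z) < 0].
      by near: t; exact: (near_ray _ rF).
    by apply/UFt; near: t.
  rewrite addrC => Ut.
  have : F (t *: n + z) <= 0.
    apply: regular_closure Ut.
    by near: t; exact: (near_ray _ (regular_near rF)).
  by apply/negP; rewrite -ltNge; near: t.
Unshelve. all: by end_near. Qed.

(** The component of [n] orthogonal to the gradient is itself tangent, hence orthogonal to [n],
    hence zero. The clause on rays then excludes a negative factor, and the unit length fixes it. *)
Lemma regular_normal_uniq (R : realType) (U : set 'rV[R]_3) F z n :
  regular_at U F z -> F z = 0 -> is_outward_normal U z n ->
  n = (enorm (grad F z))^-1 *: grad F z.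
Proof.
move=> rF F0; have [dF N0 UF] := nbhs_singleton rF.
set N := grad F z in N0 *; move=> [n1 nT nU].
have NN : dot N N != 0 by rewrite dot_eq0.
pose a := dot n N / dot N N.
have nE : n = a *: N.
  apply/eqP; rewrite -subr_eq0 -dot_eq0.
  have perp : dot N (n - a *: N) = 0.
    by rewrite dotBr dotZr /a divfK// dotC subrr.
  rewrite dotBl dotZl perp mulr0 subr0 nT//.
  by apply/(regular_tangent _ rF F0).
have a0 : 0 <= a.
  rewrite leNgt; apply/negP => a0.
  have Fn : \forall t \near (0 : R)^'+, F (t *: n + z) < 0.
    by apply: descent_ray => //; rewrite -/N nE dotZr pmulr_llt0// dot_gt0.
  near (0 : R)^'+ => t.
  have [_] : U (z - t *: n) /\ ~ closure U (z + t *: n) by near: t.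
  apply; apply: subset_closure; rewrite addrC.
  have [_ _ UFt] : [/\ differentiable F (t *: n + z),
      grad F (t *: n + z) != 0 & U (t *: n + z) <-> F (t *: n + z) < 0].
    by near: t; exact: (near_ray _ rF).
  by apply/UFt; near: t.
rewrite {1}nE; congr (_ *: _).
have eN : enorm N != 0 by rewrite enorm_eq0.
by apply: (mulIf eN); rewrite mulVf// -n1 nE enormZ ger0_norm.
Unshelve. all: by end_near. Qed.

Lemma regular_normal (R : realType) (U : set 'rV[R]_3) F z :
  regular_at U F z -> F z = 0 ->
  normal U z = (enorm (grad F z))^-1 *: grad F z.
Proof.
move=> rF F0; apply: xget_unique; first exact: regular_outward_normal.
by move=> n Hn; exact: regular_normal_uniq Hn.
Qed.

(** [G] is an explicit formula for the gradient near [z], so that its differentiability can be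
    checked directly. *)
Definition C2_at (R : realType) (U : set 'rV[R]_3) (z : 'rV[R]_3) F G : Prop :=
  [/\ regular_at U F z, \forall z' \near z, grad F z' = G z' &
      differentiable G z].

Lemma weingartenP (R : realType) (U : set 'rV[R]_3) z F G v c :
  C2_at U z F G -> F z = 0 -> curve (boundary U) z v c ->
  is_derive (0 : R) (1 : R) (normal U \o c) (weingarten U z v).
Proof.
move=> [rF FG dG] F0; have [dF N0 _] := nbhs_singleton rF.
have GN : G z != 0 by rewrite -(nbhs_singleton FG).
pose nu z' := (enorm (G z'))^-1 *: G z'.
have dnu : differentiable nu z.
  apply: differentiable_scale => //.
  apply: differentiableV; first exact: differentiable_enorm.
  by rewrite enorm_eq0.
have nuE : \forall z' \near z, boundary U z' -> nu z' = normal U z'.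
  apply: filterS2 (regular_near rF) FG => z' rF' FG' bz'.
  rewrite (regular_normal rF') ?FG'//; exact/(regular_boundary rF').
have H c' : curve (boundary U) z v c' ->
    is_derive (0 : R) (1 : R) (normal U \o c') ('d nu z v).
  move=> [c0 dc bc].
  have dnuc : differentiable nu (c' 0) by rewrite c0.
  have := is_derive_curve dc dnuc; rewrite c0.
  apply: near_eq_is_derive.
  have : \forall t \near (0 : R), boundary U (c' t) -> nu (c' t) = normal U (c' t).
    exact: (curve_near dc c0 nuE).
  by apply: filterS2 bc => t bt; apply.
move=> cc; suff : [set w | forall c, curve (boundary U) z v c ->
    is_derive (0 : R) (1 : R) (normal U \o c) w] (weingarten U z v) by apply.
by apply: xgetPex; exists ('d nu z v).
Qed.

(** * Graph coordinates *)

Lemma near_eq_differentiable (R : realType) (V W : normedModType R)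
    (f g : V -> W) x :
  (\forall z \near x, f z = g z) -> differentiable f x -> differentiable g x.
Proof.
move=> fg df; have fgx := nbhs_singleton fg.
have cd := diff_continuous df.
have gE : g \o shift x = cst (g x) + 'd f x +o_ (0 : V) id.
  apply/eqaddoP => e e0; have /eqaddoP /(_ e e0) := diff_locally df.
  have : \forall u \near (0 : V), f (u + x) = g (u + x).
    move: fg; rewrite (near_shift 0) /=; apply: filterS => u /=.
    by rewrite subr0.
  by apply: filterS2 => u /= fu; rewrite /= !fctE /= fu fgx.
apply/diff_locallyP; split; first by rewrite (diff_unique cd gE).
by rewrite (diff_unique cd gE).
Qed.

Lemma linear_rV_continuous (R : realType) n (W : normedModType R)
    (f : {linear 'rV[R]_n -> W}) : continuous f.
Proof.
move=> x; apply: differentiable_continuous.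
rewrite (_ : (f : _ -> _) =
    \sum_i (fun v : 'rV[R]_n => (v ord0 i : R) *: f (delta_mx ord0 i))).
  apply: differentiable_sum => i; apply: differentiableZl.
  exact: differentiable_coord.
apply/funext => v; rewrite fct_sumE {1}(row_sum_delta v) linear_sum.
by apply: eq_bigr => i _; rewrite linearZ.
Qed.

Lemma continuous_enorm (R : realType) n : continuous (@enorm R n).
Proof.
move=> x; apply: continuous_comp; last exact: sqrt_continuous.
by apply: differentiable_continuous; apply: differentiable_dot.
Qed.

Lemma enorm_lt_near (R : realType) n (V : normedModType R) (f : V -> 'rV[R]_n)
    z (r : R) :
  f x @[x --> z] --> f z -> enorm (f z) < r -> \forall x \near z, enorm (f x) < r.
Proof.
move=> cf; have := cvg_comp _ _ cf (@continuous_enorm R n (f z)).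
by move/cvgr_lt; apply.
Qed.

(* [L] and [M] are the tangential and vertical coordinates in the frame [Q] of
   [C2holder_boundary]; [J] and [w] invert them. *)
Definition graph_chart (R : realType) (U : set 'rV[R]_3) (z : 'rV[R]_3)
    (L : {linear 'rV[R]_3 -> 'rV[R]_2}) (M : {linear 'rV[R]_3 -> R})
    (J : {linear 'rV[R]_2 -> 'rV[R]_3}) (w : 'rV[R]_3) (r : R)
    (g : 'rV[R]_2 -> R) : Prop :=
  [/\ 0 < r, Ck 2 [set s | enorm s < r] g,
      [/\ cancel J L, forall s, M (J s) = 0, L w = 0 & M w = 1],
      forall x, x = J (L x) + M x *: w &
      \forall x \near z, U x <-> g (L (x - z)) < M (x - z)].

Lemma C2holder_graph_chart (R : realType) (alpha : R) (U : set 'rV[R]_3) z :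
  C2holder_boundary alpha U -> boundary U z ->
  exists L M J w r g, @graph_chart R U z L M J w r g.
Proof.
move=> HU /HU [Q [r [g [QQ r0 [Cg _] UQ]]]].
have QQ' := mulmx1C QQ.
pose L0 (x : 'rV[R]_3) : 'rV[R]_2 := lsubmx (x *m Q : 'rV_(2 + 1)).
pose M0 (x : 'rV[R]_3) : R := rsubmx (x *m Q : 'rV_(2 + 1)) ord0 ord0.
pose J0 (s : 'rV[R]_2) : 'rV[R]_3 := (row_mx s 0 : 'rV_(2 + 1)) *m Q^T.
have Llin : linear L0 by move=> a x y; rewrite /L0 mulmxDl -scalemxAl linearP.
have Mlin : linear (M0 : _ -> R^o).
  by move=> a x y; rewrite /M0 mulmxDl -scalemxAl linearP !mxE.
have Jlin : linear J0.
  move=> a x y; rewrite /J0 -[X in row_mx _ X](addr0 0) -{1}(scaler0 _ a).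
  by rewrite -add_row_mx -scale_row_mx mulmxDl -scalemxAl.
pose L : {linear 'rV[R]_3 -> 'rV[R]_2} :=
  HB.pack L0 (GRing.isLinear.Build _ _ _ _ _ Llin).
pose M : {linear 'rV[R]_3 -> R} :=
  HB.pack M0 (GRing.isLinear.Build _ _ _ _ _ Mlin).
pose J : {linear 'rV[R]_2 -> 'rV[R]_3} :=
  HB.pack J0 (GRing.isLinear.Build _ _ _ _ _ Jlin).
pose w : 'rV[R]_3 := (row_mx 0 1%:M : 'rV_(2 + 1)) *m Q^T.
exists L, M, J, w, r, g; split => //.
- split.
  + move=> s; rewrite /L /J /= /L0 /J0 -mulmxA QQ' mulmx1; exact: row_mxKl.
  + by move=> s; rewrite /M /J /= /M0 /J0 -mulmxA QQ' mulmx1 row_mxKr mxE.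
  + by rewrite /L /= /L0 /w -mulmxA QQ' mulmx1 row_mxKl.
  + by rewrite /M /= /M0 /w -mulmxA QQ' mulmx1 row_mxKr mxE.
- move=> x; rewrite /J /L /M /= /J0 /L0 /M0 /w scalemxAl -mulmxDl.
  rewrite scale_row_mx add_row_mx scaler0 addr0 add0r.
  set y : 'rV_(2 + 1) := x *m Q.
  rewrite (_ : _ *: 1%:M = rsubmx y); last by rewrite scalemx1 -mx11_scalar.
  by rewrite hsubmxK /y -mulmxA QQ mulmx1.
- have : \forall x \near z, enorm (x - z) < r.
    apply: (@enorm_lt_near _ _ _ (fun x => x - z)).
      exact: (cvgB cvg_id (cvg_cst _)).
    by rewrite subrr /enorm dot0l sqrtr0.
  by apply: filterS => x /UQ.
Qed.

Section graph.
Context (R : realType) (U : set 'rV[R]_3) (z : 'rV[R]_3)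
  (L : {linear 'rV[R]_3 -> 'rV[R]_2}) (M : {linear 'rV[R]_3 -> R})
  (J : {linear 'rV[R]_2 -> 'rV[R]_3}) (w : 'rV[R]_3) (r : R)
  (g : 'rV[R]_2 -> R).

(** The sign makes it negative above the graph, the side on which [U] lies. *)
Definition graph_fun (x : 'rV[R]_3) : R := g (L (x - z)) - M (x - z).

Definition graph_grad (x : 'rV[R]_3) : 'rV[R]_3 :=
  \row_i ('D_(L (delta_mx ord0 i)) g (L (x - z)) - M (delta_mx ord0 i)).

Context (C : graph_chart U z L M J w r g).

Lemma is_derive_graph_fun x v : enorm (L (x - z)) < r ->
  is_derive x v graph_fun ('D_(L v) g (L (x - z)) - M v).
Proof.
case: C => _ [dg _] _ _ _ xr; have dgx := dg _ xr.
rewrite (deriveE _ dgx).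
have ds : is_derive x v (fun x => x - z) v.
  apply: (is_derive_eq (is_deriveB (is_derive_id _ _) (is_derive_cst _ _ _))).
  by rewrite subr0.
have dL := is_derive_lin (@linear_rV_continuous _ _ _ L) ds.
have dM := is_derive_lin (@linear_rV_continuous _ _ _ M) ds.
exact: is_deriveB (is_derive_comp dL dgx) dM.
Qed.

Lemma differentiable_shift_lin (W : normedModType R)
    (f : {linear 'rV[R]_3 -> W}) x : differentiable (fun x => f (x - z)) x.
Proof.
apply: (@differentiable_comp _ _ _ _ (fun x => x - z) f) => //.
by apply: linear_differentiable; exact: linear_rV_continuous.
Qed.

Lemma graph_C2_at : C2_at U z graph_fun graph_grad.
Proof.
have [r0 [dg dg'] [_ _ Lw Mw] _ Ug] := C.
have Lr : \forall x \near z, enorm (L (x - z)) < r.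
  apply: (@enorm_lt_near _ _ _ (fun x => L (x - z))).
    exact: (differentiable_continuous (differentiable_shift_lin L z)).
  by rewrite subrr linear0 /enorm dot0l sqrtr0.
split.
- apply: filterS2 Lr Ug => x xr Ux.
  have dF : differentiable graph_fun x.
    apply: differentiableB; last exact: differentiable_shift_lin.
    exact: (differentiable_comp (differentiable_shift_lin L x) (dg _ xr)).
  split=> //; last by rewrite Ux /graph_fun subr_lt0.
  (* Along the vertical vector [w] the derivative is -1, so the gradient cannot vanish. *)
  apply/eqP => G0; have := is_derive_graph_fun w xr.
  case=> _; rewrite deriveE// gradE// G0 dot0l Lw Mw derive0 sub0r => /eqP.
  by rewrite eq_sym oppr_eq0 oner_eq0.
- apply: filterS Lr => x xr; apply/rowP => i; rewrite !mxE.
  by case: (is_derive_graph_fun (delta_mx ord0 i) xr).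
- have zr := nbhs_singleton Lr.
  apply: differentiable_row => i.
  rewrite (_ : (fun x => _) = (fun x => 'D_(L (delta_mx ord0 i)) g (L (x - z))) -
      cst (M (delta_mx ord0 i))); last by apply/funext => x; rewrite mxE.
  apply: differentiableB; last exact: differentiable_cst.
  apply: (@differentiable_comp _ _ _ _ (fun x => L (x - z))
    ('D_(L (delta_mx ord0 i)) g)); first exact: differentiable_shift_lin.
  by case: (dg' (L (delta_mx ord0 i))) => + _; apply.
Qed.

End graph.

(** * Functions of class C^k *)

Section Ck.
Context (R : realType).
Implicit Types (V W : normedModType R).

(** [Ck] recurses on derivatives as functions on the whole space, while the rules of calculus
    compute them only at points of [A]. On an open set this is enough, differentiation being
    local. *)
Lemma Ck_ext V W k (A : set V) (f g : V -> W) :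
  open A -> (forall x, A x -> f x = g x) -> Ck k A f -> Ck k A g.
Proof.
move=> oA; have nA x : A x -> \forall z \near x, A z.
  by move=> Ax; move: oA; rewrite openE => /(_ _ Ax).
elim: k f g => [|k IH] f g fg /=.
  move=> Cf x Ax; have cf : f z @[z --> x] --> f x := Cf x Ax.
  have : g z @[z --> x] --> g x; last by [].
  rewrite -fg//; apply: cvg_trans cf; apply: near_eq_cvg.
  by apply: filterS (nA _ Ax) => z /fg.
move=> [df Df]; split=> [x Ax|v].
  by apply: near_eq_differentiable (df x Ax); apply: filterS (nA _ Ax) => z /fg.
apply: IH (Df v) => x Ax; apply: near_eq_derive.
by apply: filterS (nA _ Ax) => z /fg.
Qed.

Lemma Ck_differentiable V W k (A : set V) (f : V -> W) x :
  Ck k.+1 A f -> A x -> differentiable f x.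
Proof. by case=> + _; apply. Qed.

Lemma Ck_add V W k (A : set V) (f g : V -> W) :
  open A -> Ck k A f -> Ck k A g -> Ck k A (f + g).
Proof.
move=> oA; elim: k f g => [|k IH] f g /=.
  by move=> Cf Cg x Ax; exact: (cvgD (Cf _ Ax) (Cg _ Ax)).
move=> [df Df] [dg Dg]; split=> [x Ax|v].
  by apply: differentiableD; [exact: df|exact: dg].
apply: Ck_ext oA _ (IH _ _ (Df v) (Dg v)) => x Ax.
by rewrite deriveD//; apply: diff_derivable; [exact: df|exact: dg].
Qed.

Lemma is_derive_pair V W1 W2 (f : V -> W1) (g : V -> W2) x v df dg :
  is_derive x v f df -> is_derive x v g dg ->
  is_derive x v (fun z => (f z, g z)) (df, dg).
Proof.
move=> /is_derive_line [df0 <-] /is_derive_line [dg0 <-]; apply/is_derive_line.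
move/derivable1_diffP : (df0) => df1; move/derivable1_diffP : (dg0) => dg1.
have := is_derive_diff (1 : R) (differentiable_pair df1 dg1).
by rewrite (diff_pair df1 dg1) /= -!deriveE.
Qed.

Lemma Ck_pair V W1 W2 k (A : set V) (f : V -> W1) (g : V -> W2) :
  open A -> Ck k A f -> Ck k A g -> Ck k A (fun x => (f x, g x)).
Proof.
move=> oA; elim: k f g => [|k IH] f g /=.
  by move=> Cf Cg x Ax; exact: (cvg_pair (Cf _ Ax) (Cg _ Ax)).
move=> [df Df] [dg Dg]; split=> [x Ax|v].
  by apply: differentiable_pair; [exact: df|exact: dg].
apply: Ck_ext oA _ (IH _ _ (Df v) (Dg v)) => x Ax.
have df' : is_derive x v f ('D_v f x) by apply/derivableP/diff_derivable/df.
have dg' : is_derive x v g ('D_v g x) by apply/derivableP/diff_derivable/dg.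
by case: (is_derive_pair df' dg').
Qed.

Lemma Ck_cst V W k (A : set V) (a : W) : Ck k A (cst a).
Proof.
elim: k a => [|k IH] a /=; first by move=> x _; exact: cvg_cst.
split=> [//|v].
by rewrite (_ : 'D_v (cst a) = cst 0)//; apply/funext => x; rewrite derive_cst.
Qed.

Lemma Ck_linear V W k (A : set V) (f : {linear V -> W}) :
  continuous f -> Ck k A f.
Proof.
move=> cf; case: k => [|k] /=; first by move=> x _; exact: cf.
split=> [x _|v]; first exact: linear_differentiable.
rewrite (_ : 'D_v f = cst (f v)); first exact: Ck_cst.
apply/funext => x; rewrite deriveE ?diff_lin//; exact: linear_differentiable.
Qed.

(** The derivative along [v] is [M] after ['D_(L v) f] after [L], of the same shape again, so the
    induction closes without product or general chain rules. *)
Lemma Ck_comp_linear V V' W W' k (A : set V) (A' : set V') (f : V -> W)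
    (L : {linear V' -> V}) (M : {linear W -> W'}) :
  continuous L -> continuous M -> open A' -> (forall x, A' x -> A (L x)) ->
  Ck k A f -> Ck k A' (fun x => M (f (L x))).
Proof.
move=> cL cM oA' LA; elim: k f => [|k IH] f /=.
  move=> Cf x Ax.
  exact: (cvg_comp _ _ (cvg_comp _ _ (cL x) (Cf _ (LA _ Ax))) (cM _)).
move=> [df Df].
have dfL x : A' x -> differentiable (f \o L) x.
  move=> Ax; apply: differentiable_comp; first exact: linear_differentiable.
  by apply: df; exact: LA.
split=> [x Ax|v].
  apply: (@differentiable_comp _ _ _ _ (f \o L) M); first exact: dfL.
  exact: linear_differentiable.
apply: Ck_ext oA' _ (IH _ (Df (L v))) => x Ax.
have dfx : differentiable f (L x) by apply: df; exact: LA.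
have dL : is_derive x v L (L v).
  have := is_derive_diff v (linear_differentiable x cL).
  by rewrite (diff_lin _ cL).
have := is_derive_lin cM (is_derive_comp dL dfx).
by case=> _ ->; rewrite deriveE.
Qed.

End Ck.

(** * Parametrization of the product of two boundaries *)

Lemma near_fst (T1 T2 : topologicalType) (z : T1 * T2) (P : set T1) :
  nbhs z.1 P -> \forall y \near z, P y.1.
Proof. by move=> /(@cvg_fst _ _ (nbhs z.1) (nbhs z.2)). Qed.

Lemma near_snd (T1 T2 : topologicalType) (z : T1 * T2) (P : set T2) :
  nbhs z.2 P -> \forall y \near z, P y.2.
Proof. by move=> /(@cvg_snd _ _ (nbhs z.1) (nbhs z.2)). Qed.

Section graph_param.
Context (R : realType) (U : set 'rV[R]_3) (z : 'rV[R]_3)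
  (L : {linear 'rV[R]_3 -> 'rV[R]_2}) (M : {linear 'rV[R]_3 -> R})
  (J : {linear 'rV[R]_2 -> 'rV[R]_3}) (w : 'rV[R]_3) (r : R)
  (g : 'rV[R]_2 -> R).
Context (C : graph_chart U z L M J w r g) (Uz : boundary U z).

Definition graph_param (s : 'rV[R]_2) : 'rV[R]_3 := z + (J s + g s *: w).

Lemma graph_near_boundary :
  \forall x \near z, boundary U x <-> graph_fun z L M g x = 0.
Proof.
have [rF _ _] := graph_C2_at C; have := regular_near rF.
by apply: filterS => x; exact: regular_boundary.
Qed.

Lemma graph_fun_param s : graph_fun z L M g (graph_param s) = 0.
Proof.
have [_ _ [JL MJ Lw Mw] _ _] := C.
rewrite /graph_fun /graph_param [z + _]addrC addrK (linearD L) (linearD M).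
rewrite !linearZ /= JL MJ Lw Mw.
by rewrite scaler0 addr0 add0r [_ *: 1]mulr1 subrr.
Qed.


Lemma graph_param_lin s : L (graph_param s) = L z + s.
Proof.
have [_ _ [JL MJ Lw Mw] _ _] := C.
by rewrite /graph_param !linearD linearZ /= JL Lw scaler0 addr0.
Qed.

Lemma graph_fun_paramK x : graph_fun z L M g x = 0 -> graph_param (L (x - z)) = x.
Proof.
have [_ _ _ E _] := C; rewrite /graph_fun => /eqP; rewrite subr_eq0 => /eqP gM.
by rewrite /graph_param gM -E addrC subrK.
Qed.

Lemma graph_param0 : graph_param 0 = z.
Proof.
have := @graph_fun_paramK z; rewrite subrr linear0; apply.
exact/(nbhs_singleton graph_near_boundary).1.
Qed.

(** [K] makes each factor of the product a function of all four parameters. *)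
Lemma Ck_graph_param m (K : {linear 'rV[R]_m -> 'rV[R]_2}) (A : set 'rV[R]_m) :
  open A -> (forall s, A s -> enorm (K s) < r) ->
  Ck 2 A (fun s => graph_param (K s)).
Proof.
move=> oA AK; have [_ Cg _ _ _] := C.
have cK := @linear_rV_continuous _ _ _ K.
have slin : linear ( *:%R^~ w : R^o -> 'rV[R]_3).
  by move=> a x y; rewrite scalerDl scalerA.
pose S : {linear R -> 'rV[R]_3} :=
  HB.pack ( *:%R^~ w) (GRing.isLinear.Build _ _ _ _ _ slin).
have cS : continuous S by exact: scalel_continuous.
pose JK : {linear 'rV[R]_m -> 'rV[R]_3} := J \o K.
have CJ : Ck 2 A JK by exact/Ck_linear/linear_rV_continuous.
have CS : Ck 2 A (fun s => S (g (K s))) by apply: Ck_comp_linear Cg.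
exact: Ck_ext (Ck_add oA (Ck_cst 2 A z) (Ck_add oA CJ CS)).
Qed.

End graph_param.

Lemma product_local_param (R : realType) (alpha : R) (U1 U2 : set 'rV[R]_3) z1 z2 :
  C2holder_boundary alpha U1 -> C2holder_boundary alpha U2 ->
  boundary U1 z1 -> boundary U2 z2 ->
  exists phi : 'rV[R]_4 -> 'rV[R]_3 * 'rV[R]_3,
    local_param (boundary U1 `*` boundary U2) (z1, z2) phi.
Proof.
move=> H1 H2 b1 b2.
have [L1 [M1 [J1 [w1 [r1 [g1 C1]]]]]] := C2holder_graph_chart H1 b1.
have [L2 [M2 [J2 [w2 [r2 [g2 C2]]]]]] := C2holder_graph_chart H2 b2.
pose K1 : {linear 'rV[R]_4 -> 'rV[R]_2} :=
  (@lsubmx R 1 2 2 : {linear 'rV[R]_(2 + 2) -> 'rV[R]_2}).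
pose K2 : {linear 'rV[R]_4 -> 'rV[R]_2} :=
  (@rsubmx R 1 2 2 : {linear 'rV[R]_(2 + 2) -> 'rV[R]_2}).
pose phi (s : 'rV[R]_4) :=
  (graph_param z1 J1 w1 g1 (K1 s), graph_param z2 J2 w2 g2 (K2 s)).
have phi0 : phi 0 = (z1, z2).
  by rewrite /phi !linear0 (graph_param0 C1)// (graph_param0 C2).
pose A := [set s : 'rV[R]_4 | enorm (K1 s) < r1] `&` [set s | enorm (K2 s) < r2].
have oK (K : {linear 'rV[R]_4 -> 'rV[R]_2}) r : open [set s | enorm (K s) < r].
  rewrite openE => s /= sr; apply: (@enorm_lt_near _ _ _ K) => //.
  exact: linear_rV_continuous.
have oA : open A by exact: openI.
have A0 : A 0.
  have [r10 _ _ _ _] := C1; have [r20 _ _ _ _] := C2.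
  by split => /=; rewrite linear0 /enorm dot0l sqrtr0.
have Cphi : Ck 2 A phi.
  apply: Ck_pair => //.
    by apply: (Ck_graph_param C1) => // s [].
  by apply: (Ck_graph_param C2) => // s [].
have dphi : differentiable phi 0 by exact: Ck_differentiable Cphi A0.
exists phi; split => //.
(* The graph function vanishes on the whole range of [graph_param], but its zeros are known to be
   boundary points only near the base point; hence the restriction to the interior of [B]. *)
- pose B := [set s | (boundary U1 `*` boundary U2) (phi s)].
  have B0 : nbhs (0 : 'rV[R]_4) B.
    have cphi : phi s @[s --> (0 : 'rV[R]_4)] --> (z1, z2).
      by rewrite -phi0; exact: differentiable_continuous.
    have n1 : \forall s \near (0 : 'rV[R]_4), boundary U1 (phi s).1 <->
        graph_fun z1 L1 M1 g1 (phi s).1 = 0 :=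
      cphi _ (@near_fst _ _ (z1, z2) _ (graph_near_boundary C1)).
    have n2 : \forall s \near (0 : 'rV[R]_4), boundary U2 (phi s).2 <->
        graph_fun z2 L2 M2 g2 (phi s).2 = 0 :=
      cphi _ (@near_snd _ _ (z1, z2) _ (graph_near_boundary C2)).
    apply: filterS2 n1 n2 => s n1 n2; split.
      by apply/n1; exact: (graph_fun_param C1).
    by apply/n2; exact: (graph_fun_param C2).
  exists (A `&` B°); split.
  + by apply: openI => //; exact: open_interior.
  + by split.
  + have [df Df] := Cphi; split; first by move=> x [/df].
    move=> v; have [df' Df'] := Df v; split; first by move=> x [/df'].
    by move=> v' x [/(Df' v')].
  + by move=> _ [s [_ /interior_subset Bs] <-].
(* If [P \o phi] is affine with linear part [K], then [P] applied to the differential is [K]. The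
   tangential coordinates of the two factors thus recover both halves of [h], which gives
   injectivity. *)
- have dlin (P : {linear ('rV[R]_3 * 'rV[R]_3)%type -> 'rV[R]_2})
      (K : {linear 'rV[R]_4 -> 'rV[R]_2}) a : continuous P ->
      (forall s, P (phi s) = a + K s) -> forall h, P ('d phi 0 h) = K h.
    move=> cP PK v; have dP := is_derive_lin cP (is_derive_diff v dphi).
    have dK : is_derive (0 : 'rV[R]_4) v K (K v).
      have cK := @linear_rV_continuous _ _ _ K.
      have := is_derive_diff v (linear_differentiable (0 : 'rV[R]_4) cK).
      by rewrite (diff_lin _ cK).
    have := is_deriveD (is_derive_cst a (0 : 'rV[R]_4) v) dK.
    rewrite (_ : cst a + _ = (fun s => P (phi s))); last exact/esym/funext.
    by case: dP => _ <- [_ ->]; rewrite add0r.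
  have cfst : continuous (fst : 'rV[R]_3 * 'rV[R]_3 -> _).
    by move=> y; exact: cvg_fst.
  have csnd : continuous (snd : 'rV[R]_3 * 'rV[R]_3 -> _).
    by move=> y; exact: cvg_snd.
  have cL (P : {linear ('rV[R]_3 * 'rV[R]_3)%type -> 'rV[R]_3})
      (L : {linear 'rV[R]_3 -> 'rV[R]_2}) : continuous P -> continuous (L \o P).
    by move=> cP y; apply: continuous_comp; [exact: cP|exact: linear_rV_continuous].
  move=> h h' hh'.
  have e1 : K1 h = K1 h'.
    rewrite -!(dlin (L1 \o fst) K1 (L1 z1)) ?hh'//; try exact: cL.
      by move=> s; exact: (graph_param_lin C1).
    by move=> s; exact: (graph_param_lin C1).
  have e2 : K2 h = K2 h'.
    rewrite -!(dlin (L2 \o snd) K2 (L2 z2)) ?hh'//; try exact: cL.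
      by move=> s; exact: (graph_param_lin C2).
    by move=> s; exact: (graph_param_lin C2).
  have hK (x : 'rV[R]_(2 + 2)) : row_mx (K1 x) (K2 x) = x by exact: hsubmxK.
  by rewrite -(hK h) -(hK h') e1 e2.
- move=> W W0.
  pose I1 : 'M[R]_(2, 2 + 2) := row_mx 1%:M 0.
  pose I2 : 'M[R]_(2, 2 + 2) := row_mx 0 1%:M.
  (* [psi] reads off the tangential coordinates and so inverts [phi] on the two surfaces. As a sum
     of linear images of [y.1 - z1] and [y.2 - z2] it is visibly continuous. *)
  pose psi (y : 'rV[R]_3 * 'rV[R]_3) : 'rV[R]_(2 + 2) :=
    mulmxr I1 (L1 (y.1 - z1)) + mulmxr I2 (L2 (y.2 - z2)).
  have psiE y : psi y = row_mx (L1 (y.1 - z1)) (L2 (y.2 - z2)).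
    rewrite /psi /= /I1 /I2 !mul_mx_row !mulmx1 !mulmx0 add_row_mx.
    by rewrite addr0 add0r.
  have cpsi : psi y @[y --> (z1, z2)] --> (0 : 'rV[R]_4).
    have -> : (0 : 'rV[R]_4) = psi (z1, z2) by rewrite /psi !subrr !linear0 addr0.
    have d1 := @differentiable_shift_lin R z1 _ (mulmxr I1 \o L1) z1.
    have d2 := @differentiable_shift_lin R z2 _ (mulmxr I2 \o L2) z2.
    have c1 : mulmxr I1 (L1 (y.1 - z1)) @[y --> (z1, z2)] -->
        mulmxr I1 (L1 (z1 - z1)).
      exact: (cvg_comp _ _ (@cvg_fst _ _ (nbhs z1) (nbhs z2) _)
        (differentiable_continuous d1)).
    have c2 : mulmxr I2 (L2 (y.2 - z2)) @[y --> (z1, z2)] -->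
        mulmxr I2 (L2 (z2 - z2)).
      exact: (cvg_comp _ _ (@cvg_snd _ _ (nbhs z1) (nbhs z2) _)
        (differentiable_continuous d2)).
    exact: (cvgD c1 c2).
  rewrite near_withinE.
  have n0 : \forall y \near (z1, z2), W (psi y) := cpsi _ W0.
  have n1 := @near_fst _ _ (z1, z2) _ (graph_near_boundary C1).
  have n2 := @near_snd _ _ (z1, z2) _ (graph_near_boundary C2).
  apply: filterS3 n0 n1 n2 => -[y1 y2] /= Wy n1 n2 [/n1 b1' /n2 b2'].
  exists (psi (y1, y2)) => //; rewrite /phi psiE /K1 /K2 /=.
  rewrite row_mxKl row_mxKr /=.
  by rewrite (graph_fun_paramK C1)// (graph_fun_paramK C2).
Qed.

(** * The path length and the spheroid *)

Lemma dot_delta (R : realType) n (u : 'rV[R]_n) i :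
  dot u (delta_mx ord0 i) = u ord0 i.
Proof.
rewrite /dot (bigD1 i)//= big1 => [|j ji].
  by rewrite mxE !eqxx mulr1 addr0.
by rewrite mxE (negbTE ji) andbF mulr0.
Qed.

Lemma is_derive_lp (R : realType) (V : normedModType R) p (f g : V -> 'rV[R]_3)
    x v df dg :
  is_derive x v f df -> is_derive x v g dg -> f x != p -> f x != g x ->
  is_derive x v (fun z => lp p (f z) (g z) : R)
    (dot (f x - p) df / enorm (f x - p) +
     dot (f x - g x) (df - dg) / enorm (f x - g x)).
Proof.
move=> Hf Hg fp fg.
have Hfp : is_derive x v (fun z => f z - p) df.
  by apply: (is_derive_eq (is_deriveB Hf (is_derive_cst _ _ _))); rewrite subr0.
have := is_deriveD (is_derive_enorm Hfp _) (is_derive_enorm (is_deriveB Hf Hg) _).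
rewrite !subr_eq0 => /(_ fp fg).
by under [X in _ -> is_derive _ _ X _]eq_fun do rewrite /lp (enormBC p).
Qed.

Definition lp_grad (R : realType) (p y z : 'rV[R]_3) : 'rV[R]_3 :=
  (enorm (z - p))^-1 *: (z - p) + (enorm (z - y))^-1 *: (z - y).

Lemma dot_lp_grad (R : realType) (p y z v : 'rV[R]_3) :
  dot (lp_grad p y z) v =
  dot (z - p) v / enorm (z - p) + dot (z - y) v / enorm (z - y).
Proof. by rewrite [LHS]dotDl !dotZl ![_^-1 * _]mulrC. Qed.

Lemma grad_lp (R : realType) (p y z : 'rV[R]_3) : z != p -> z != y ->
  grad (fun x => lp p x y) z = lp_grad p y z.
Proof.
move=> zp zy; apply/rowP => i; rewrite mxE.
have [_ ->] := is_derive_lp (is_derive_id z (delta_mx ord0 i))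
  (is_derive_cst y z (delta_mx ord0 i)) zp zy.
by rewrite subr0 -dot_lp_grad dot_delta.
Qed.

Lemma differentiable_lp (R : realType) (V : normedModType R) p
    (f g : V -> 'rV[R]_3) x :
  differentiable f x -> differentiable g x -> f x != p -> f x != g x ->
  differentiable (fun z => lp p (f z) (g z) : R) x.
Proof.
move=> df dg fp fg.
have dp : differentiable (fun z => p - f z) x.
  by apply: differentiableB => //; exact: differentiable_cst.
apply: differentiableD; apply: differentiable_enorm => //.
- by rewrite subr_eq0 eq_sym.
- exact: differentiableB.
- by rewrite subr_eq0.
Qed.

Lemma differentiable_lp_grad (R : realType) (p y z : 'rV[R]_3) :
  z != p -> z != y -> differentiable (lp_grad p y) z.
Proof.
move=> zp zy.
have d a : z != a ->
    differentiable (fun z : 'rV[R]_3 => (enorm (z - a))^-1 *: (z - a)) z.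
  move=> za; have ds : differentiable (fun z : 'rV[R]_3 => z - a) z.
    by apply: differentiableB => //; exact: differentiable_cst.
  apply: differentiable_scale => //; apply: differentiableV.
    by apply: differentiable_enorm; rewrite ?subr_eq0.
  by rewrite enorm_eq0 subr_eq0.
exact: differentiableD (d _ zp) (d _ zy).
Qed.

Lemma near_neq (R : realType) (V : normedModType R) (x a : V) : x != a ->
  \forall z \near x, z != a.
Proof.
move=> xa; apply/nbhs_ballP; exists `|x - a|; first by rewrite /= normr_gt0 subr_eq0.
by move=> z; rewrite -ball_normE /=; apply: contraTneq => ->; rewrite ltxx.
Qed.

(** A zero of [lp_grad] is a point where the unit vectors coming from the two foci cancel, that is,
    a point of the segment between them; there the spheroid degenerates. *)
Lemma spheroid_C2_at (R : realType) (p x0 y0 : 'rV[R]_3) :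
  x0 != p -> x0 != y0 -> lp_grad p y0 x0 != 0 ->
  C2_at (spheroid_inside p x0 y0) x0 (fun x => lp p x y0 - lp p x0 y0)
    (lp_grad p y0).
Proof.
move=> xp xy g0; have dg := differentiable_lp_grad xp xy.
have gradF z : z != p -> z != y0 ->
    grad (fun x => lp p x y0 - lp p x0 y0) z = lp_grad p y0 z.
  move=> zp zy; rewrite -grad_lp//; apply/rowP => i; rewrite !mxE.
  have [dl _] := is_derive_lp (is_derive_id z (delta_mx ord0 i))
    (is_derive_cst y0 z (delta_mx ord0 i)) zp zy.
  by rewrite deriveB// derive_cst subr0.
have np := near_neq xp; have ny := near_neq xy.
split=> //; last by apply: filterS2 np ny.
have ng : \forall z \near x0, lp_grad p y0 z != 0.
  exact: (differentiable_continuous dg (near_neq g0)).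
apply: filterS3 np ny ng => z zp zy zg; split.
- apply: differentiableB; last exact: differentiable_cst.
  by apply: differentiable_lp => //; exact: differentiable_cst.
- by rewrite gradF.
- by rewrite /spheroid_inside /= subr_lt0.
Qed.

(** If there is no outward normal, the default value 0 is orthogonal to everything, so the identity
    is available at every point of a curve. *)
Lemma normal_tangent (R : realType) (U : set 'rV[R]_3) x v :
  tangent (boundary U) x v -> dot (normal U x) v = 0.
Proof.
rewrite /normal; case: xgetP => [n _ [_ + _] tv|_ _]; first exact.
by rewrite dot0l.
Qed.

(* Second variation: differentiate <nu(X), X'> = 0 along the curve. *)
Lemma weingarten_accel (R : realType) (U : set 'rV[R]_3) x F G
    (X X1 : R -> 'rV[R]_3) X2 :
  C2_at U x F G -> F x = 0 -> X 0 = x ->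
  (\forall t \near (0 : R), is_derive t (1 : R) X (X1 t)) ->
  is_derive (0 : R) (1 : R) X1 X2 ->
  (\forall t \near (0 : R), boundary U (X t)) ->
  dot (weingarten U x (X1 0)) (X1 0) + dot (normal U x) X2 = 0.
Proof.
move=> HF F0 X0 dX dX1 bX.
have cX : curve (boundary U) x (X1 0) X by split=> //; exact: nbhs_singleton dX.
have dn := weingartenP HF F0 cX.
have [_] := is_derive_dot dn dX1; rewrite /= X0 => <-.
rewrite (near_eq_derive (g := cst (0 : R))) ?derive_cst//.
have bX' := near_join bX.
apply: filterS2 dX bX' => t dXt bXt; apply: normal_tangent.
(* The orthogonality is differentiated, so it is needed at all small [t]: a shift of time makes [X]
   a curve through [X t] with velocity [X1 t]. *)
exists (fun s => X (s + t)); split; first by rewrite add0r.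
  have := (is_derive_line _ _ _ _).1 dXt.
  by under eq_fun do rewrite [_ *: 1]mulr1.
by move: bXt; rewrite (near_shift 0); apply: filterS => s; rewrite /= subr0.
Qed.

Lemma is_derive_unit (R : realType) (V : normedModType R) n
    (f : V -> 'rV[R]_n) x v df :
  is_derive x v f df -> f x != 0 ->
  is_derive x v (fun z => (enorm (f z))^-1 *: f z)
    ((enorm (f x))^-1 *: df - (dot (f x) df / enorm (f x) ^+ 3) *: f x).
Proof.
move=> Hf f0; have e0 : enorm (f x) != 0 by rewrite enorm_eq0.
have H := is_derive_div (is_derive_cst (1 : R) x v) (is_derive_enorm Hf f0) e0.
have Hi : is_derive x v (fun z => (enorm (f z))^-1 : R)
    (- (dot (f x) df / enorm (f x) ^+ 3)).
  apply: near_eq_is_derive (is_derive_eq H _).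
    by apply: nearW => z; rewrite div1r.
  by rewrite /cst mul0r sub0r mul1r; congr (- _); field.
apply: (is_derive_eq (is_derive_scale Hi Hf)).
by rewrite scaleNr addrC.
Qed.

(* On the level set the unit normal N of l satisfies |grad l| N = grad l; the
   derivative of |grad l| disappears after pairing with a tangent vector. *)
Lemma spheroid_weingarten (R : realType) (p x0 y0 v : 'rV[R]_3) :
  x0 != p -> x0 != y0 -> lp_grad p y0 x0 != 0 -> dot (lp_grad p y0 x0) v = 0 ->
  enorm (lp_grad p y0 x0) * dot (weingarten (spheroid_inside p x0 y0) x0 v) v =
  (dot v v / enorm (x0 - p) - dot (x0 - p) v ^+ 2 / enorm (x0 - p) ^+ 3) +
  (dot v v / enorm (x0 - y0) - dot (x0 - y0) v ^+ 2 / enorm (x0 - y0) ^+ 3).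
Proof.
move=> xp xy g0 gv; have HF := spheroid_C2_at xp xy g0.
have [rF FG dG] := HF; set F := (fun x => _) in rF FG HF.
have F0 : F x0 = 0 by rewrite /F subrr.
have [c cc] : tangent (boundary (spheroid_inside p x0 y0)) x0 v.
  by apply/(regular_tangent _ rF F0); rewrite (nbhs_singleton FG).
have dn := weingartenP HF F0 cc; have [c0 dc bc] := cc.
have nE : \forall t \near (0 : R), enorm (lp_grad p y0 (c t)) *:
    normal (spheroid_inside p x0 y0) (c t) = lp_grad p y0 (c t).
  have nb : \forall z \near x0, boundary (spheroid_inside p x0 y0) z ->
      enorm (lp_grad p y0 z) *: normal (spheroid_inside p x0 y0) z
      = lp_grad p y0 z.
    apply: filterS2 (regular_near rF) FG => z rFz FGz bz.
    have Fz := (regular_boundary rFz).1 bz.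
    have [_ gz _] := nbhs_singleton rFz.
    by rewrite (regular_normal rFz Fz) -FGz scalerA mulfV ?scale1r// enorm_eq0.
  by apply: filterS2 bc (curve_near dc c0 nb) => t bt; apply.
have dgc : differentiable (lp_grad p y0) (c 0) by rewrite c0.
have gc0 : (lp_grad p y0 \o c) 0 != 0 by rewrite /= c0.
have dg := is_derive_curve dc dgc.
have dL := is_derive_scale (is_derive_enorm dg gc0) dn.
(* The derivative of [lp_grad] along [c] is obtained in two ways: from its length times the normal
   ([dL]), and as the derivative of a sum of two unit vectors. *)
have dsh a : x0 != a -> is_derive (0 : R) (1 : R)
    (fun t => (enorm (c t - a))^-1 *: (c t - a))
    ((enorm (x0 - a))^-1 *: v -
      (dot (x0 - a) v / enorm (x0 - a) ^+ 3) *: (x0 - a)).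
  move=> xa; rewrite -c0; apply: is_derive_unit; last by rewrite c0 subr_eq0.
  by apply: (is_derive_eq (is_deriveB dc (is_derive_cst _ _ _))); rewrite subr0.
have [_ e2] := is_deriveD (dsh _ xp) (dsh _ xy).
have := near_eq_is_derive nE dL; case=> _; rewrite e2 /= c0.
have nv : dot (normal (spheroid_inside p x0 y0) x0) v = 0.
  by apply: normal_tangent; exists c.
move=> /(congr1 (fun u => dot u v)).
rewrite !(dotDl, dotNl, dotZl) nv mulr0 add0r => <-.
rewrite -!dotBl; ring.
Qed.

(** * Consequences of minimality *)

(** A singular Hessian has a nonzero kernel vector [h], along which the second derivative would be
    0. The first derivative along [h] is expanded in coordinates near [x], and not only at [x],
    because it is differentiated again. *)
Lemma hessian_pos_det (R : realType) m (f : 'rV[R]_m -> R) x :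
  (\forall z \near x, differentiable f z) ->
  (forall u, differentiable ('D_u f) x) ->
  (forall h, h != 0 -> 0 < 'D_h ('D_h f) x) -> \det (hessian f x) != 0.
Proof.
move=> df Df pos; apply/det0P => -[h h0 hH].
pose e i : 'rV[R]_m := delta_mx ord0 i.
have lin g z : differentiable g z -> 'D_h g z = \sum_i h ord0 i * 'D_(e i) g z.
  move=> dg; rewrite deriveE// gradE// dotC.
  by apply: eq_bigr => i _; rewrite mxE.
have := pos h h0; suff -> : 'D_h ('D_h f) x = 0 by rewrite ltxx.
have De : \forall z \near x, 'D_h f z = (\sum_j (h ord0 j \*: 'D_(e j) f)) z.
  apply: filterS df => z dz; rewrite lin// fct_sumE.
  by apply: eq_bigr => j _.
rewrite (near_eq_derive (f := 'D_h f) h De) derive_sum => [|j]; last first.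
  by apply: derivableZ; exact/diff_derivable/Df.
apply: big1 => j _; rewrite deriveZ; last exact/diff_derivable/Df.
have := congr1 (fun v : 'rV_m => v ord0 j) hH; rewrite !mxE => hj.
rewrite lin// -[RHS](scaler0 _ (h ord0 j)) -[in RHS]hj; congr (_ *: _).
by apply: eq_bigr => i _; rewrite mxE.
Qed.

Lemma unit_parallel (R : realType) n (u v : 'rV[R]_n) : enorm u = 1 ->
  (forall w, dot u w = 0 -> dot v w = 0) -> v = dot v u *: u.
Proof.
move=> u1 uv; have uu : dot u u = 1 by rewrite -sqr_enorm u1 expr1n.
apply/eqP; rewrite -subr_eq0 -dot_eq0.
have perp : dot u (v - dot v u *: u) = 0.
  by rewrite dotBr dotZr uu mulr1 dotC subrr.
by rewrite dotBl dotZl perp mulr0 subr0 uv.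
Qed.

Lemma C2_normal (R : realType) (U : set 'rV[R]_3) z F G :
  C2_at U z F G -> boundary U z ->
  [/\ F z = 0, is_outward_normal U z (normal U z) &
      forall v, tangent (boundary U) z v <-> dot (normal U z) v = 0].
Proof.
move=> [rF _ _] /(regular_boundary rF) F0; have [_ N0 _] := nbhs_singleton rF.
rewrite (regular_normal rF F0); split => //; first exact: regular_outward_normal.
move=> v; split=> [/(regular_tangent _ rF F0) Nv|].
  by rewrite dotZl Nv mulr0.
rewrite dotZl => /eqP; rewrite mulf_eq0 invr_eq0 enorm_eq0 (negbTE N0) /= => /eqP.
by move/(regular_tangent _ rF F0).
Qed.

(** The parameters in [[0, t]] sent into [U] form a relatively open set. It is also closed: a point
    of the segment in the closure but outside the open set [U] would be a boundary point closer to
    [x] than [y]. Connectedness of the interval concludes. *)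
Lemma nearest_segment (R : realType) (U : set 'rV[R]_3) x y t :
  open U -> U x -> x != y ->
  (forall y', boundary U y' -> enorm (x - y) <= enorm (x - y')) ->
  0 <= t -> t < 1 -> U (t *: (y - x) + x).
Proof.
move=> oU Ux xy ymin t0 t1.
pose c (s : R) := s *: (y - x) + x.
have cc : continuous c.
  move=> s; apply: differentiable_continuous; apply/derivable1_diffP.
  have [d _] := is_deriveD (is_derive_scale (is_derive_id s (1 : R))
    (is_derive_cst (y - x) _ _)) (is_derive_cst x s (1 : R)).
  exact: d.
pose B := [set` `[0, t]] `&` c @^-1` U.
have BE : B = [set` `[0, t]].
  apply: (@segment_connected R 0 t).
  - by exists 0; split; rewrite /= ?in_itv /= ?lexx// /c scale0r add0r.
  - exists (c @^-1` U) => //; exact: (continuousP _).1.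
  - exists (c @^-1` closure U).
      by apply: closed_comp => //; exact: closed_closure.
    apply/seteqP; split=> s [st cs]; split=> //.
      exact: subset_closure.
    apply: contrapT => ncs; have bs : boundary U (c s).
      by split=> //; move/interior_subset.
    have := ymin _ bs; rewrite /c opprD addrCA subrr addr0 enormN enormZ.
    rewrite (enormBC x) leNgt -[X in _ < X]mul1r.
    move: st; rewrite /= in_itv /= => /andP[s0 st].
    rewrite ltr_pM2r ?enorm_gt0 ?subr_eq0 1?eq_sym// ger0_norm//.
    by rewrite (le_lt_trans st).
have : B t by rewrite BE /= in_itv /= t0 lexx.
by case.
Qed.

(** Criticality of the distance to [x] gives the direction up to sign. If the normal pointed back
    towards [x], the outward ray would run along the segment, inside [U] by [nearest_segment]. *)
Lemma nearest_normal (R : realType) (U : set 'rV[R]_3) x y F G :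
  C2_at U y F G -> open U -> U x -> boundary U y ->
  (forall y', boundary U y' -> enorm (x - y) <= enorm (x - y')) ->
  normal U y = (enorm (x - y))^-1 *: (y - x).
Proof.
move=> HF oU Ux by_ ymin; have [F0 [n1 _ nU] tn] := C2_normal HF by_.
have xy : x != y.
  apply: contraPneq Ux => -> Uy; case: by_ => _; apply.
  by move: oU; rewrite openE => /(_ _ Uy).
have d0 : 0 < enorm (x - y) by rewrite enorm_gt0 subr_eq0.
set b := _ *: _; have b1 : enorm b = 1.
  rewrite /b enormBC; apply: enorm_normalize.
  by rewrite subr_eq0 eq_sym.
have bv v : dot (normal U y) v = 0 -> dot b v = 0.
  move=> /tn [c [c0 dc bc]].
  have dy : is_derive (0 : R) (1 : R) (fun t => enorm (c t - x))
      (dot (c 0 - x) v / enorm (c 0 - x)).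
    apply: is_derive_enorm; last by rewrite c0 subr_eq0 eq_sym.
    by apply: (is_derive_eq (is_deriveB dc (is_derive_cst _ _ _))); rewrite subr0.
  have := derive_local_min dy; rewrite c0 => E; rewrite /b dotZl enormBC mulrC E//.
  by apply: filterS bc => t bt; rewrite !(enormBC _ x); exact: ymin.
have := unit_parallel n1 bv; set a := dot b _ => ba.
have := b1; rewrite ba enormZ n1 mulr1 => a1.
have [a0|a0] := leP 0 a.
  by move: a1; rewrite ger0_norm// => ->; rewrite scale1r.
have aN1 : a = -1 by move: a1; rewrite ltr0_norm// => /(canRL (@opprK _)).
have : \forall t \near (0 : R)^'+, t < enorm (x - y) by exact: nbhs_right_lt.
move=> tlt; near (0 : R)^'+ => t.
have [_] : U (y - t *: normal U y) /\ ~ closure U (y + t *: normal U y).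
  by near: t.
case; apply: subset_closure.
have -> : normal U y = - b by rewrite ba aN1 scaleN1r opprK.
have -> : y + t *: - b = (1 - t / enorm (x - y)) *: (y - x) + x.
  rewrite scalerN /b scalerA scalerBl scale1r.
  by rewrite addrAC subrK.
have t0 : 0 < t by [].
apply: nearest_segment => //.
  by rewrite subr_ge0 ler_pdivrMr// mul1r; apply: ltW; near: t.
by rewrite gtrBl divr_gt0.
Unshelve. all: by end_near. Qed.

(** * Second derivative of the length along a parametrization *)

Lemma is_derive_fst (R : realType) (V W1 W2 : normedModType R)
    (f : V -> W1 * W2) x v df :
  is_derive x v f df -> is_derive x v (fun z => (f z).1) df.1.
Proof.
apply: (@is_derive_lin R _ _ _ f (fst : {linear (W1 * W2)%type -> W1})).
by move=> y; exact: cvg_fst.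
Qed.

Lemma is_derive_snd (R : realType) (V W1 W2 : normedModType R)
    (f : V -> W1 * W2) x v df :
  is_derive x v f df -> is_derive x v (fun z => (f z).2) df.2.
Proof.
apply: (@is_derive_lin R _ _ _ f (snd : {linear (W1 * W2)%type -> W2})).
by move=> y; exact: cvg_snd.
Qed.

Lemma differentiable_fst (R : realType) (V W1 W2 : normedModType R)
    (f : V -> W1 * W2) x :
  differentiable f x -> differentiable (fun z => (f z).1) x.
Proof.
move=> df; apply: (@differentiable_comp _ _ _ _ f
  (fst : {linear (W1 * W2)%type -> W1})) => //.
by apply: linear_differentiable => y; exact: cvg_fst.
Qed.

Lemma differentiable_snd (R : realType) (V W1 W2 : normedModType R)
    (f : V -> W1 * W2) x :
  differentiable f x -> differentiable (fun z => (f z).2) x.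
Proof.
move=> df; apply: (@differentiable_comp _ _ _ _ f
  (snd : {linear (W1 * W2)%type -> W2})) => //.
by apply: linear_differentiable => y; exact: cvg_snd.
Qed.

Lemma differentiable_div (R : realType) (V : normedModType R) (f g : V -> R) x :
  differentiable f x -> differentiable g x -> g x != 0 ->
  differentiable (fun z => f z / g z : R) x.
Proof.
by move=> df dg g0; exact: (differentiableM df (differentiableV dg g0)).
Qed.

(** The explicit first derivative [E] is valid on a whole neighbourhood of [z], hence may be
    differentiated once more. The vectors [a] and [b] are the accelerations of the two end
    points. *)
Lemma derive2_lp (R : realType) (V : normedModType R) p
    (phi : V -> 'rV[R]_3 * 'rV[R]_3) z x y :
  (\forall s \near z, differentiable phi s) ->
  (forall u, differentiable ('D_u phi) z) ->
  phi z = (x, y) -> x != p -> x != y ->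
  let f := fun s => lp p (phi s).1 (phi s).2 in
  [/\ \forall s \near z, differentiable f s,
      forall u, differentiable ('D_u f) z &
      forall h v w a b, 'D_h phi z = (v, w) -> 'D_h ('D_h phi) z = (a, b) ->
        'D_h ('D_h f) z =
          (dot v v + dot (x - p) a) / enorm (x - p)
          - dot (x - p) v ^+ 2 / enorm (x - p) ^+ 3
          + ((dot (v - w) (v - w) + dot (x - y) (a - b)) / enorm (x - y)
          - dot (x - y) (v - w) ^+ 2 / enorm (x - y) ^+ 3)].
Proof.
move=> dphi dDphi ez xp' xy' f.
have xp : (phi z).1 != p by rewrite ez.
have xy : (phi z).1 != (phi z).2 by rewrite ez.
have dz := nbhs_singleton dphi.
have d1 := differentiable_fst dz; have d2 := differentiable_snd dz.
have np : \forall s \near z, (phi s).1 != p.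
  exact: (differentiable_continuous d1 (near_neq xp)).
have ny : \forall s \near z, (phi s).1 != (phi s).2.
  have xy0 : (phi z).1 - (phi z).2 != 0 by rewrite subr_eq0.
  have ny0 : \forall s \near z, (phi s).1 - (phi s).2 != 0.
    exact: (differentiable_continuous (differentiableB d1 d2) (near_neq xy0)).
  by apply: filterS ny0 => s; rewrite subr_eq0.
pose E u s := dot ((phi s).1 - p) ('D_u phi s).1 / enorm ((phi s).1 - p) +
  dot ((phi s).1 - (phi s).2) (('D_u phi s).1 - ('D_u phi s).2) /
  enorm ((phi s).1 - (phi s).2).
have fE u : \forall s \near z, 'D_u f s = E u s.
  apply: filterS3 dphi np ny => s ds sp sy.
  have dus : is_derive s u phi ('D_u phi s) by exact/derivableP/diff_derivable.
  by have [_ ->] := is_derive_lp (is_derive_fst dus) (is_derive_snd dus) sp sy.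
have dp : differentiable (fun s => (phi s).1 - p) z.
  by apply: differentiableB => //; exact: differentiable_cst.
have dy := differentiableB d1 d2.
have ep : enorm ((phi z).1 - p) != 0 by rewrite enorm_eq0 subr_eq0.
have ey : enorm ((phi z).1 - (phi z).2) != 0 by rewrite enorm_eq0 subr_eq0.
split.
- apply: filterS3 dphi np ny => s ds sp sy.
  apply: differentiable_lp => //; first exact: differentiable_fst.
  exact: differentiable_snd.
- move=> u; have du := dDphi u.
  have du1 := differentiable_fst du; have du2 := differentiable_snd du.
  have dE : differentiable (E u) z.
    have xp0 : (phi z).1 - p != 0 by rewrite subr_eq0.
    have xy0 : (phi z).1 - (phi z).2 != 0 by rewrite subr_eq0.
    exact: (differentiableD
      (differentiable_div (differentiable_dot dp du1)
        (differentiable_enorm dp xp0) ep)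
      (differentiable_div (differentiable_dot dy (differentiableB du1 du2))
        (differentiable_enorm dy xy0) ey)).
  by apply: near_eq_differentiable dE; apply: filterS (fE u) => s ->.
- move=> h v w a b ev ea.
  rewrite (near_eq_derive (f := 'D_h f) h (fE h)).
  have dh : is_derive z h phi (v, w).
    by rewrite -ev; exact/derivableP/diff_derivable.
  have dhh : is_derive z h ('D_h phi) (a, b).
    by rewrite -ea; exact/derivableP/diff_derivable.
  have h1 : is_derive z h (fun s => (phi s).1) v := is_derive_fst dh.
  have h2 : is_derive z h (fun s => (phi s).2) w := is_derive_snd dh.
  have hh1 : is_derive z h (fun s => ('D_h phi s).1) a := is_derive_fst dhh.
  have hh2 : is_derive z h (fun s => ('D_h phi s).2) b := is_derive_snd dhh.
  have hp : is_derive z h (fun s => (phi s).1 - p) v.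
    by apply: (is_derive_eq (is_deriveB h1 (is_derive_cst _ _ _))); rewrite subr0.
  have hy := is_deriveB h1 h2; have hhy := is_deriveB hh1 hh2.
  have xp0 : (phi z).1 - p != 0 by rewrite subr_eq0.
  have xy0 : ((fun s => (phi s).1) - (fun s => (phi s).2)) z != 0.
    by rewrite /= subr_eq0.
  have q1 := is_derive_div (is_derive_dot hp hh1) (is_derive_enorm hp xp0) ep.
  have q2 := is_derive_div (is_derive_dot hy hhy) (is_derive_enorm hy xy0) ey.
  have [_ ->] := is_deriveD q1 q2.
  rewrite -![((fun s => (phi s).1) - _) z]/((phi z).1 - (phi z).2).
  rewrite -![((fun s => ('D_h phi s).1) - _) z]/(('D_h phi z).1 - ('D_h phi z).2).
  rewrite ez in ep ey *; rewrite ev /=.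
  have alg (k c e : R) : e != 0 ->
      k / e - c * (c / e) / e ^+ 2 = k / e - c ^+ 2 / e ^+ 3.
    by move=> e0; field.
  by congr (_ + _); exact: alg.
Qed.

(* Completing the square, with m = 1/d - 1/r and r / ((r - d) d) = 1 / (m d^2). *)
Lemma square_completion (R : realType) n (v w : 'rV[R]_n) (d r : R) :
  0 < d -> d < r ->
  0 <= r / ((r - d) * d) * dot v v - 2 * dot v w / d
       + dot w w / d - r^-1 * dot w w.
Proof.
move=> d0 dr; have r0 := lt_trans d0 dr.
have rd : 0 < r - d by rewrite subr_gt0.
have m0 : 0 < (r - d) / (r * d) by rewrite divr_gt0// mulr_gt0.
have := mulr_ge0 (ltW m0) (dot_ge0 (w - (r / (r - d)) *: v)).
rewrite !dotE (dotC w v); set vv := dot v v; set vw := dot v w; set ww := dot w w.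
congr (0 <= _); field.
by rewrite !lt0r_neq0.
Qed.

(** [S] and [T] stand for the values of the two curvature forms at [v] and [w]. A strict hypothesis
    says nothing at the zero vector, hence the cases: for [v = 0] strictness comes from
    [1 / r < 1 / d], for [w = 0] from the positive constant in front of [dot v v], and otherwise
    from whichever hypothesis is strict. *)
Lemma coupled_form_pos (R : realType) n (v w : 'rV[R]_n) (d r S T : R) :
  0 < d -> d < r -> (v != 0) || (w != 0) ->
  (v = 0 -> S = 0) -> (w = 0 -> T = 0) ->
  (T <= r^-1 * dot w w /\ (v != 0 -> r / ((r - d) * d) * dot v v < S)) \/
  ((w != 0 -> T < r^-1 * dot w w) /\ r / ((r - d) * d) * dot v v <= S) ->
  0 < S - 2 * dot v w / d + dot w w / d - T.
Proof.
move=> d0 dr vw S0 T0; have r0 := lt_trans d0 dr.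
have := square_completion v w d0 dr; set q := r / _ => sq.
have q0 : 0 < q by rewrite divr_gt0// mulr_gt0// subr_gt0.
have [v0|v0] := eqVneq v 0.
  have w0 : w != 0 by move: vw; rewrite v0 eqxx.
  have ww : 0 < dot w w by rewrite dot_gt0.
  have rd : 0 < dot w w / d - r^-1 * dot w w.
    rewrite mulrC -mulrBl mulr_gt0// subr_gt0 ltf_pV2//.
  rewrite S0// v0 !dot0l; case=> -[]; first by move=> T1 _; lra.
  by move=> /(_ w0) T1 _; lra.
have vv : 0 < dot v v by rewrite dot_gt0.
have [w0|w0] := eqVneq w 0.
  rewrite T0// w0 !dot0r; have qv := mulr_gt0 q0 vv.
  by case=> -[]; [move=> _ /(_ isT) S1|move=> _ S1]; lra.
by case=> -[]; [move=> T1 /(_ isT) S1|move=> /(_ isT) T1 S1]; lra.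
Qed.

Lemma M1set_facts (R : realType) (p x0 y0 : 'rV[R]_3) (D Omega : set 'rV[R]_3) :
  M1set p D Omega (x0, y0) ->
  [/\ boundary D x0, boundary Omega y0,
      forall x y, boundary D x -> boundary Omega y -> lp p x0 y0 <= lp p x y,
      0 < dot (normal D x0) (p - x0) & 0 < dot (normal D x0) (y0 - x0)].
Proof.
move=> [/= [[b1 b2] e] n1 n2]; split=> // x y bx by_.
rewrite e; apply: ge_inf; last by exists (x, y).
(* The infimum is a lower bound only for a set that is bounded below; here 0 bounds all lengths. *)
by exists 0 => _ [[x' y'] _ <-]; rewrite addr_ge0 ?enorm_ge0.
Qed.

(* At a minimum point, grad_x l is normal to the boundary of D; the sign comes
   from the condition defining M_1. *)
Lemma critical_x (R : realType) (U : set 'rV[R]_3) p x0 y0 F G :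
  C2_at U x0 F G -> boundary U x0 -> x0 != p -> x0 != y0 ->
  (forall x, boundary U x -> lp p x0 y0 <= lp p x y0) ->
  0 < dot (normal U x0) (p - x0) -> 0 < dot (normal U x0) (y0 - x0) ->
  lp_grad p y0 x0 != 0 /\
  lp_grad p y0 x0 = - enorm (lp_grad p y0 x0) *: normal U x0.
Proof.
move=> HF bx xp xy xmin np ny; have [F0 [n1 _ nU] tn] := C2_normal HF bx.
have gv v : dot (normal U x0) v = 0 -> dot (lp_grad p y0 x0) v = 0.
  move=> /tn [c [c0 dc bc]].
  have cp : c 0 != p by rewrite c0.
  have cy : c 0 != y0 by rewrite c0.
  have := derive_local_min (is_derive_lp dc (is_derive_cst y0 _ _) cp cy).
  rewrite c0 subr0 -dot_lp_grad; apply.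
  by apply: filterS bc => t bt; exact: xmin.
have gE := unit_parallel n1 gv.
have g0 : dot (lp_grad p y0 x0) (normal U x0) < 0.
  rewrite dot_lp_grad -[x0 - p]opprB -[x0 - y0]opprB !dotNl !(dotC _ (normal _ _)).
  have ep : 0 < enorm (- (p - x0)) by rewrite enormN enorm_gt0 subr_eq0 eq_sym.
  have ey : 0 < enorm (- (y0 - x0)) by rewrite enormN enorm_gt0 subr_eq0 eq_sym.
  have := divr_gt0 np ep; have := divr_gt0 ny ey; lra.
split.
  by apply: contraTneq g0 => ->; rewrite dot0l ltxx.
by rewrite {2}gE enormZ n1 mulr1 ltr0_norm// opprK.
Qed.

Lemma domain_neq (R : realType) (p x0 y0 : 'rV[R]_3) (D Omega : set 'rV[R]_3) :
  open Omega -> closure D `<=` Omega -> ~ closure Omega p ->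
  boundary D x0 -> boundary Omega y0 -> [/\ Omega x0, x0 != p & x0 != y0].
Proof.
move=> oO DO np [cx _] [_ iy]; have Ox := DO _ cx; split=> //.
  by apply/eqP => xp; apply: np; rewrite -xp; exact: subset_closure.
apply/eqP => xy; apply: iy; rewrite -xy.
by move: oO; rewrite openE => /(_ _ Ox).
Qed.

Lemma C2holder_C2_at (R : realType) (alpha : R) (U : set 'rV[R]_3) z :
  C2holder_boundary alpha U -> boundary U z -> exists F G, C2_at U z F G.
Proof.
move=> HU bz; have [L [M [J [w [r [g C]]]]]] := C2holder_graph_chart HU bz.
by exists (graph_fun z L M g), (graph_grad z L M g); exact: graph_C2_at C.
Qed.

Lemma near_line (R : realType) (V : normedModType R) (h : V) (P : set V) :
  nbhs (0 : V) P -> \forall t \near (0 : R), P (t *: h).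
Proof.
move=> /(near_cone h 0); apply: filterS => t /(_ 0).
by rewrite normr0 scaler0 !addr0; apply.
Qed.

Lemma grad_local_min (R : realType) m (f : 'rV[R]_m -> R) :
  differentiable f 0 -> (\forall s \near (0 : 'rV[R]_m), f 0 <= f s) ->
  grad f 0 = 0.
Proof.
move=> df fmin; apply/rowP => i; rewrite !mxE.
have dfi : is_derive (0 : 'rV[R]_m) (delta_mx ord0 i) f ('D_(delta_mx ord0 i) f 0).
  exact/derivableP/diff_derivable.
apply: (derive_local_min ((is_derive_line _ _ _ _).1 dfi)).
rewrite scale0r add0r; apply: filterS (near_line (delta_mx ord0 i) fmin) => t.
by rewrite addr0.
Qed.

(* Restricting [phi] to the line spanned by [h] gives a curve of [U]. *)
Lemma accel_along_line (R : realType) m (U : set 'rV[R]_3) x F G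
    (phi psi : 'rV[R]_m -> 'rV[R]_3) h a :
  C2_at U x F G -> F x = 0 -> phi 0 = x ->
  (\forall s \near (0 : 'rV[R]_m), [/\ differentiable phi s, 'D_h phi s = psi s &
    boundary U (phi s)]) ->
  differentiable psi 0 -> 'D_h psi 0 = a ->
  tangent (boundary U) x (psi 0) /\
  dot (weingarten U x (psi 0)) (psi 0) + dot (normal U x) a = 0.
Proof.
move=> HF F0 phi0 /(near_line h) dphi dD <-.
have dl (t : R) : is_derive t (1 : R) (fun t : R => t *: h) h.
  apply: (is_derive_eq (is_derive_scale (is_derive_id t (1 : R))
    (is_derive_cst h t (1 : R)))).
  by rewrite scaler0 addr0 scale1r.
have dX : \forall t \near (0 : R),
    is_derive t (1 : R) (fun t : R => phi (t *: h)) (psi (t *: h)).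
  apply: filterS dphi => t [dt <- _]; rewrite deriveE//.
  exact: (is_derive_curve (dl t) dt).
have bX : \forall t \near (0 : R), boundary U (phi (t *: h)).
  by apply: filterS dphi => t [].
have dX1 : is_derive (0 : R) (1 : R) (fun t : R => psi (t *: h)) ('D_h psi 0).
  have dD0 : differentiable psi ((0 : R) *: h) by rewrite scale0r.
  have := is_derive_curve (dl 0) dD0.
  by rewrite scale0r -deriveE.
have X0 : phi ((0 : R) *: h) = x by rewrite scale0r.
have := weingarten_accel HF F0 X0 dX dX1 bX; rewrite scale0r => ->; split=> //.
by exists (fun t : R => phi (t *: h)); split=> //; have := nbhs_singleton dX;
  rewrite scale0r.
Qed.

Unset Implicit Arguments.

Theorem proposition6p3 (R : realType) (alpha0 : R) (Omega D : set 'rV[R]_3)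
    (p x0 y0 : 'rV[R]_3) :
  0 < alpha0 -> alpha0 <= 1 ->
  domain Omega -> bounded_set Omega -> C2holder_boundary alpha0 Omega ->
  open D -> closure D `<=` Omega -> C2holder_boundary alpha0 D ->
  connected (Omega `\` closure D) ->
  ~ closure Omega p ->
  M1set p D Omega (x0, y0) ->
  let d0 := enorm (x0 - y0) in
  let S_in := spheroid_inside p x0 y0 in
  let TOmega := tangent (boundary Omega) y0 in
  let TD := tangent (boundary D) x0 in
  let AOmega := weingarten Omega y0 in
  let ADS := fun v => enorm (grad (fun x => lp p x y0) x0) *:
                        (weingarten D x0 v + weingarten S_in x0 v) in
  (exists r : R, d0 < r /\
     (form_le TOmega AOmega (fun v => r^-1 *: v) /\
      form_lt TD (fun v => (r / ((r - d0) * d0)) *: v) ADS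
      \/
      form_lt TOmega AOmega (fun v => r^-1 *: v) /\
      form_le TD (fun v => (r / ((r - d0) * d0)) *: v) ADS)) ->
  nondegenerate_critical 4 (boundary D `*` boundary Omega)
    (fun z : 'rV[R]_3 * 'rV[R]_3 => lp p z.1 z.2) (x0, y0).
Proof.
move=> _ _ [_ oO _] _ HO oD DO HD _ np M d0 S_in TOmega TD AOmega ADS [r [dr cond]].
have [bx by_ lmin nup nuy] := M1set_facts M.
have [Ox xp xy] := domain_neq oO DO np bx by_.
have [F1 [G1 C1]] := C2holder_C2_at HD bx.
have [F2 [G2 C2]] := C2holder_C2_at HO by_.
have [F10 _ tn1] := C2_normal C1 bx; have [F20 _ tn2] := C2_normal C2 by_.
have [g0 gE] := critical_x C1 bx xp xy (fun x bx' => lmin x y0 bx' by_) nup nuy.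
(* With [x0] fixed the leg from [p] cancels, so [y0] is a point of the boundary of [Omega] nearest
   to [x0]. *)
have nO : normal Omega y0 = d0^-1 *: (y0 - x0).
  apply: (nearest_normal C2) => // y' by'.
  by have := lmin x0 y' bx by'; rewrite lerD2l.
have d0_gt0 : 0 < d0 by rewrite enorm_gt0 subr_eq0.
split; first exact: product_local_param HD HO bx by_.
move=> phi [phi0 [W [oW W0 Cphi phiW]] inj _].
have nW : nbhs (0 : 'rV[R]_4) W by exact: open_nbhs_nbhs.
have [dW DW] := Cphi.
have dphi : \forall s \near (0 : 'rV[R]_4), differentiable phi s.
  by apply: filterS nW => s; exact: dW.
have dDphi u : differentiable ('D_u phi) 0 by case: (DW u) => + _; exact.
have bphi : \forall s \near (0 : 'rV[R]_4),
    boundary D (phi s).1 /\ boundary Omega (phi s).2.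
  apply: filterS nW => s Ws.
  have : (boundary D `*` boundary Omega) (phi s) by apply: phiW; exists s.
  by case.
have [df dDf Hh] := derive2_lp dphi dDphi phi0 xp xy.
split.
  apply: grad_local_min; first exact: nbhs_singleton df.
  by apply: filterS bphi => s [b1 b2]; rewrite /= phi0; exact: lmin.
apply: (hessian_pos_det df dDf) => h h0.
case ev : ('D_h phi 0) => [v w]; case ea : ('D_h ('D_h phi) 0) => [a b].
rewrite (Hh _ _ _ _ _ ev ea).
have dph0 := nbhs_singleton dphi.
have dhh : is_derive (0 : 'rV[R]_4) h ('D_h phi) (a, b).
  by rewrite -ea; exact/derivableP/diff_derivable.
have n1 : \forall s \near (0 : 'rV[R]_4), [/\ differentiable (fun s => (phi s).1) s,
    'D_h (fun s => (phi s).1) s = ('D_h phi s).1 & boundary D (phi s).1].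
  apply: filterS2 dphi bphi => s ds [bs _]; split=> //; first exact: differentiable_fst.
  have dhs : is_derive s h phi ('D_h phi s) by exact/derivableP/diff_derivable.
  by case: (is_derive_fst dhs).
have n2 : \forall s \near (0 : 'rV[R]_4), [/\ differentiable (fun s => (phi s).2) s,
    'D_h (fun s => (phi s).2) s = ('D_h phi s).2 & boundary Omega (phi s).2].
  apply: filterS2 dphi bphi => s ds [_ bs]; split=> //; first exact: differentiable_snd.
  have dhs : is_derive s h phi ('D_h phi s) by exact/derivableP/diff_derivable.
  by case: (is_derive_snd dhs).
have [_ e1] := is_derive_fst dhh; have [_ e2] := is_derive_snd dhh.
have phi01 : (phi 0).1 = x0 by rewrite phi0.
have phi02 : (phi 0).2 = y0 by rewrite phi0.
have [tv accv] := accel_along_line C1 F10 phi01 n1 (differentiable_fst (dDphi h)) e1.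
have [tw accw] := accel_along_line C2 F20 phi02 n2 (differentiable_snd (dDphi h)) e2.
rewrite ev /= in tv accv tw accw.
(* The differential of [phi] is injective, so a nonzero [h] cannot have velocity 0 in both
   factors. *)
have vw : (v != 0) || (w != 0).
  rewrite -negb_and; apply: contra h0 => /andP[/eqP v0 /eqP w0].
  apply/eqP/inj; rewrite linear0 -deriveE//.
  by rewrite ev v0 w0.
have nv : dot (normal D x0) v = 0 by exact/tn1.
have gv : dot (lp_grad p y0 x0) v = 0 by rewrite gE dotZl nv mulr0.
have sph := spheroid_weingarten xp xy g0 gv.
(* [w] is tangent at [y0], where the normal is parallel to [y0 - x0]; this removes [w] from the last
   squared term of the second derivative. *)
have xyw : dot (x0 - y0) w = 0.
  have /tn2 := tw; rewrite nO dotZl => /eqP.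
  rewrite mulf_eq0 invr_eq0 (gt_eqF d0_gt0) /= => /eqP.
  by rewrite -[y0 - x0]opprB dotNl => /eqP; rewrite oppr_eq0 => /eqP.
(* The terms in [a] add up to [dot (lp_grad p y0 x0) a], which is the part of [ADS] due to [D]; the
   squared terms and the multiples of [dot v v] are the part due to the spheroid; the term in [b] is
   the form of [AOmega]. *)
have -> : (dot v v + dot (x0 - p) a) / enorm (x0 - p)
      - dot (x0 - p) v ^+ 2 / enorm (x0 - p) ^+ 3
      + ((dot (v - w) (v - w) + dot (x0 - y0) (a - b)) / enorm (x0 - y0)
      - dot (x0 - y0) (v - w) ^+ 2 / enorm (x0 - y0) ^+ 3)
    = dot (ADS v) v - 2 * dot v w / d0 + dot w w / d0 - dot (AOmega w) w.
  have -> : dot (ADS v) v = dot (lp_grad p y0 x0) a +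
      enorm (lp_grad p y0 x0) * dot (weingarten S_in x0 v) v.
    have ga : dot (lp_grad p y0 x0) a =
        - enorm (lp_grad p y0 x0) * dot (normal D x0) a by rewrite {1}gE dotZl.
    rewrite /ADS grad_lp// dotZl dotDl ga (canRL (addrK _) accv) sub0r.
    by rewrite mulrDr mulrN mulNr.
  rewrite /S_in sph dot_lp_grad -/d0.
  have -> : dot (AOmega w) w = dot (x0 - y0) b / d0.
    rewrite (canRL (addrK _) accw) sub0r nO dotZl -[y0 - x0]opprB dotNl.
    by rewrite mulrN opprK mulrC.
  have -> : dot (x0 - y0) (v - w) = dot (x0 - y0) v by rewrite dotBr xyw subr0.
  rewrite (dotBr a b) (dotBl v w) !(dotBr v w) (dotC w v).
  set xpa := dot (x0 - p) a; set xya := dot (x0 - y0) a; set xyb := dot _ b.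
  ring.
apply: (coupled_form_pos d0_gt0 dr vw).
- by move=> ->; rewrite dot0r.
- by move=> ->; rewrite dot0r.
case: cond => -[cO cD]; [left|right].
  by split; [have := cO w tw; rewrite dotZl|move=> v0; have := cD v tv v0; rewrite dotZl].
by split; [move=> w0; have := cO w tw w0; rewrite dotZl|have := cD v tv; rewrite dotZl].
Qed.
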